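(* Assume the standing setting below. Let $W$ satisfy conditions (W1) and (W2) with some $p>0$, $c_p>0$, and let the regularity condition $f_\rho=L_K^r g_\rho$ hold with some $r>0$ and $g_\rho\in L^2_{\rho_{\mathcal X}}$. Let $T\ge 2$ and let $\{f_t\}_{t=1}^{T+1}$ be generated by the online algorithm with step size $\eta=\frac{1}{\eta_0}T^{-\frac{2r}{2r+1}}$, where $$\eta_0\ge \max\left\{C_W\kappa^2,\ \left(\tfrac{1}{e}+2\kappa^2 W_+'(0)\right)^2\right\}.$$ Then $$\mathbb{E}_{Z^T}\left[\|f_{T+1}-f_\rho\|_\rho^2\right]\le C \max\left\{T^{-\frac{2r}{2r+1}}\log T,\ T^{\frac{2p+2}{2r+1}}\sigma^{-4p}\right\},$$ where $C$ is a constant independent of $T$ and $\sigma$ (depending only on $r,p,c_p,\kappa,M,C_W,W_+'(0),\eta_0,\|g_\rho\|_\rho,\|f_\rho\|_\rho$ and $\mathcal{E}(f_\rho)$).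
   Context: Standing setting: $\mathcal X$ is a measurable space, $\mathcal Y\subseteq\mathbb R$, and $\rho$ is a probability measure on $\mathcal X\times\mathcal Y$ with $|y|\le M$ $\rho$-a.s. for some constant $M>0$; $\rho_{\mathcal X}$ is its marginal on $\mathcal X$, $\rho(\cdot|x)$ the conditional distribution, and $f_\rho(x)=\int y\,d\rho(y|x)$ is the regression function. $\|\cdot\|_\rho$ is the norm of $L^2_{\rho_{\mathcal X}}$. $K:\mathcal X\times\mathcal X\to\mathbb R$ is a measurable, symmetric, positive semi-definite kernel with $\kappa:=\sup_{x}\sqrt{K(x,x)}<\infty$; $\mathcal H_K$ is its RKHS with norm $\|\cdot\|_K$, and $K_x:=K(x,\cdot)$, so $f(x)=\langle f,K_x\rangle_K$. The integral operator $L_K f(u)=\int_{\mathcal X} f(x)K(x,u)\,d\rho_{\mathcal X}(x)$ is compact, self-adjoint and positive on $L^2_{\rho_{\mathcal X}}$ (and also acts on $\mathcal H_K$); its powers $L_K^r$ are defined by spectral calculus. A windowing function $W:[0,\infty)\to\mathbb R$ satisfies (W1): $W'_+(0)>0$, $W'(s)>0$ for $s>0$, and $C_W:=\sup_{s>0}|W'(s)|<\infty$; and (W2): there are $p>0,c_p>0$ with $|W'(s)-W'_+(0)|\le c_p s^p$ for all $s>0$. Online algorithm: $\{z_t=(x_t,y_t)\}_{t\ge1}$ are i.i.d. samples from $\rho$, $\sigma>0$ is a scale parameter, $\eta>0$ a constant step size, $f_1=0$ and $$f_{t+1}=f_t-\eta W'(\xi_{t,\sigma})(f_t(x_t)-y_t)K_{x_t},\qquad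 \xi_{t,\sigma}=\frac{(y_t-f_t(x_t))^2}{\sigma^2}.$$ $\mathbb E_{Z^k}$ denotes expectation with respect to $z_1,\dots,z_k$. For measurable $f$, $\mathcal E(f):=\int_{\mathcal X\times\mathcal Y}(f(x)-y)^2\,d\rho$. *)

(* Defs.v *)
From HB Require Import structures.
From mathcomp Require Import all_boot all_order all_algebra.
From mathcomp Require Import all_classical all_reals all_analysis measurable_realfun.
Set Implicit Arguments. Unset Strict Implicit. Unset Printing Implicit Defensive.
Import Order.TTheory GRing.Theory Num.Theory.
Import numFieldNormedType.Exports.
Local Open Scope classical_set_scope.
Local Open Scope ring_scope.

Section Defs.
Context {R : realType} {d : measure_display} {X : measurableType d}.

Section Marginal.
Variable rho : probability (X * R)%type R.
Definition marginal : set X -> \bar R := pushforward rho (@fst X R).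
Let mf : measurable_fun [set: X * R] fst := @measurable_fst _ _ X R.
Let marginal0 : marginal set0 = 0%E.
Proof. by rewrite /marginal /pushforward preimage_set0 measure0. Qed.
Let marginal_ge0 A : (0 <= marginal A)%E.
Proof. by rewrite /marginal /pushforward; apply: measure_ge0. Qed.
Let marginal_sigma_additive : semi_sigma_additive marginal.
Proof.
move=> F mF tF mUF; rewrite /marginal /pushforward preimage_bigcup.
apply: measure_semi_sigma_additive.
- by move=> n; rewrite -[X in measurable X]setTI; exact: mf.
- apply/trivIsetP => /= i j _ _ ij; rewrite -preimage_setI.
  by move/trivIsetP : tF => /(_ _ _ _ _ ij) ->//; rewrite preimage_set0.
- by rewrite -preimage_bigcup -[X in measurable X]setTI; exact: mf.
Qed.
HB.instance Definition _ := isMeasure.Build _ _ _ marginal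
  marginal0 marginal_ge0 marginal_sigma_additive.
End Marginal.

Definition sqL2 (mu : {measure set X -> \bar R}) (f : X -> R) : \bar R :=
  (\int[mu]_x ((f x) ^+ 2)%:E)%E.

Definition inL2 (mu : {measure set X -> \bar R}) (f : X -> R) : Prop :=
  measurable_fun setT f /\ (sqL2 mu f < +oo)%E.

Definition normL2 (mu : {measure set X -> \bar R}) (f : X -> R) : R :=
  Num.sqrt (fine (sqL2 mu f)).

Definition ipL2 (mu : {measure set X -> \bar R}) (f g : X -> R) : R :=
  fine (\int[mu]_x (f x * g x)%:E)%E.

Definition LK (mu : {measure set X -> \bar R}) (K : X -> X -> R) (f : X -> R) : X -> R :=
  fun u => fine (\int[mu]_x (f x * K x u)%:E)%E.

Definition psd_kernel (K : X -> X -> R) : Prop :=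
  forall (n : nat) (xs : 'I_n -> X) (c : 'I_n -> R),
    0 <= \sum_(i < n) \sum_(j < n) c i * c j * K (xs i) (xs j).

Definition kappa (K : X -> X -> R) : R := sup [set Num.sqrt (K x x) | x in setT].

(* spectral decomposition of L_K on L^2(mu): L_K f = sum_i lam_i <f,phi_i> phi_i
   (convergence in L^2(mu)), with lam_i >= 0 and the phi_i with lam_i <> 0
   orthonormal; indices with lam_i = 0 are padding and play no role. *)
Definition spectral_system (mu : {measure set X -> \bar R}) (K : X -> X -> R)
  (lam : nat -> R) (phi : nat -> X -> R) : Prop :=
  [/\ forall i, 0 <= lam i,
      forall i, inL2 mu (phi i),
      forall i j, lam i != 0 -> lam j != 0 ->
        ipL2 mu (phi i) (phi j) = (i == j)%:R &
      forall f, inL2 mu f ->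
        (fun n => sqL2 mu (fun u => LK mu K f u -
            \sum_(i < n) lam i * ipL2 mu f (phi i) * phi i u)) @ \oo --> 0%E].

Definition is_LKpow (mu : {measure set X -> \bar R}) (K : X -> X -> R) (r : R)
  (g h : X -> R) : Prop :=
  exists (lam : nat -> R) (phi : nat -> X -> R),
    spectral_system mu K lam phi /\
    (fun n => sqL2 mu (fun u => h u -
        \sum_(i < n) (lam i `^ r) * ipL2 mu g (phi i) * phi i u)) @ \oo --> 0%E.

Definition regression (cond : X -> probability R R) : X -> R :=
  fun x => fine (\int[cond x]_y y%:E)%E.

Definition lsq_error (rho : probability (X * R)%type R) (f : X -> R) : \bar R :=
  (\int[rho]_z ((f z.1 - z.2) ^+ 2)%:E)%E.

End Defs.

Section Window.
Context {R : realType}.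

Definition CW (W : R -> R) : R := sup [set `|derive1 W s| | s in `]0, +oo[%classic].

(* W' on [0,oo): right derivative W0 at 0, derivative elsewhere *)
Definition Wd (W : R -> R) (W0 : R) (s : R) : R :=
  if s == 0 then W0 else derive1 W s.

End Window.

Section Online.
Context {R : realType} {d : measure_display} {X : measurableType d}.

Definition online_step (W : R -> R) (W0 : R) (K : X -> X -> R) (eta sigma : R)
  (f : X -> R) (z : X * R) : X -> R :=
  fun u => f u - eta * Wd W W0 ((z.2 - f z.1) ^+ 2 / sigma ^+ 2) * (f z.1 - z.2) * K z.1 u.

Definition online (W : R -> R) (W0 : R) (K : X -> X -> R) (eta sigma : R)
  (zs : seq (X * R)) : X -> R :=
  foldl (online_step W W0 K eta sigma) (fun _ => 0) zs.

(* E_{Z^n}[F] = int rho(dz_1) ... int rho(dz_n) F [:: z_1; ...; z_n]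
   (z_1,...,z_n i.i.d. with law rho) *)
Fixpoint expect (rho : probability (X * R)%type R) (n : nat)
  (F : seq (X * R) -> \bar R) : \bar R :=
  match n with
  | 0 => F [::]
  | n'.+1 => (\int[rho]_z expect rho n' (fun s => F (z :: s)))%E
  end.

End Online.

(* Main.v *)
(* With a = eta W'(0), P = 1 - a L_K and residual f_t - f_rho, one step of the
   algorithm reads  P (f_t - f_rho) + martingale difference + perturbation, the last
   term coming from W'(xi) - W'(0).  A psd kernel with a kappa^2 <= 1 satisfies the
   smoothing bound |P^k K_x|^2 <= kappa^2 / (a (k + 1)), obtained by an energy argument
   in the RKHS norm; only finite kernel combinations and their integrals are needed, so
   the RKHS is never constructed.  Propagating the quantities E |P^k (f_n - f_rho)|^2
   through the Markov operator of the algorithm, with Young weights whose sum stays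
   bounded, gives the bias |P^T f_rho|^2, a variance of order eta log T (times the
   error itself, which is absorbed for large T), and a perturbation term of order
   T^((2p+2)/(2r+1)) sigma^(-4p).  The bias is bounded by spectral calculus.  For the
   finitely many T for which the absorption fails, the a priori bound
   |f_t|_K^2 <= t eta C_W M^2 suffices. *)
Require Import Defs.
From HB Require Import structures.
From mathcomp Require Import all_boot all_order all_algebra.
From mathcomp Require Import all_classical all_reals all_analysis measurable_realfun giry.
From mathcomp Require Import ring lra.
Import Order.TTheory GRing.Theory Num.Theory.
Import numFieldNormedType.Exports.
Local Open Scope classical_set_scope.
Local Open Scope ring_scope.
Set Implicit Arguments.
Unset Strict Implicit.
Unset Printing Implicit Defensive.

(** * Square-integrable functions *)

(** The orders are all tied to tau = T^(1/(2r+1)), which equals eta0 eta T. The bias (eta T)^(-2r)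
    and the variance eta log T then agree up to the logarithm. The iterates satisfy |f_t|_K^2 <= t
    eta C_W M^2, so |f_t(x) - y| is of order sqrt tau, and (W2) makes the perturbation of the
    gradient of order eps = tau^(p+1/2) sigma^(-2p). Smoothing turns it into eta T eps^2, that is
    tau^(2p+2) sigma^(-4p). The obstacle is that the gradient noise has a second moment growing with
    the current error, so the recursion contains the unpropagated error with a coefficient summing
    to a multiple of La, of order eta log T. A strong induction absorbs it once 8 e^2 La <= 1. The
    condition eta C_W kappa^2 <= 1 serves twice: it gives the RKHS norm bound, and, as W'_+(0) <=
    C_W, it gives a kappa^2 <= 1. *)

Lemma discriminant_le {R : realFieldType} (A B C : R) : 0 <= A ->
  (forall c, 0 <= c ^+ 2 * A + 2 * c * B + C) -> B ^+ 2 <= A * C.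
Proof.
move=> A0 H.
have [A00|An0] := eqVneq A 0.
  have [->|Bn0] := eqVneq B 0; first by rewrite A00 mul0r expr0n.
  (* With a vanishing leading coefficient the expression is affine in c; this c gives it the value
     -1. *)
  have := H (- (C + 1) / (2 * B)); rewrite A00 (_ : _ + _ = -1); last by field.
  by rewrite ler0N1.
have Ap : 0 < A by rewrite lt_def An0.
have := H (- (B / A)); rewrite (_ : _ + _ = C - B ^+ 2 / A); last by field.
by rewrite subr_ge0 ler_pdivrMr// mulrC.
Qed.

Section SquareIntegrable.
Context {R : realType} {d : measure_display} {X : measurableType d}.
Variable mu : probability X R.
Implicit Types u v w : X -> R.

Notation integr f := (mu.-integrable setT (EFin \o f)).

Lemma integrable_le (f g : X -> R) : measurable_fun setT f ->
  (forall x, `|f x| <= g x) -> integr g -> integr f.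
Proof.
move=> mf fg ig; apply: le_integrable ig => //; first exact/measurable_EFinP.
by move=> x _ /=; rewrite lee_fin (le_trans (fg x))// ler_norm.
Qed.

Lemma integrable_cst (c : R) : integr (fun=> c).
Proof. exact: finite_measure_integrable_cst. Qed.

Lemma integrable_add (f g : X -> R) :
  integr f -> integr g -> integr (fun x => f x + g x).
Proof. by move=> fi gi; have := integrableD measurableT fi gi. Qed.

Lemma integrable_scale (c : R) (f : X -> R) : integr f -> integr (fun x => c * f x).
Proof. by move=> fi; have := integrableZl measurableT c fi. Qed.

Lemma integrable_measurable (f : X -> R) : integr f -> measurable_fun setT f.
Proof. by case/integrableP => /measurable_EFinP. Qed.

Lemma Rintegral_lin (c : R) (f g : X -> R) : integr f -> integr g ->
  \int[mu]_x (f x + c * g x) = \int[mu]_x f x + c * \int[mu]_x g x.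
Proof.
move=> fi gi; rewrite RintegralD// ?RintegralZl//; exact: integrable_scale.
Qed.

Lemma Rintegral_mono (f g : X -> R) : integr f -> integr g ->
  (forall x, f x <= g x) -> \int[mu]_x f x <= \int[mu]_x g x.
Proof. by move=> fi gi fg; apply: le_Rintegral. Qed.

Lemma Rintegral_cst1 (c : R) : \int[mu]_x c = c.
Proof. by rewrite Rintegral_cst//= probability_setT mulr1. Qed.

Lemma inL2_integrable u : inL2 mu u -> integr (fun x => u x ^+ 2).
Proof.
case=> mu_ ioo; apply/integrableP; split.
  apply/measurable_EFinP; exact: measurable_funX.
rewrite (eq_integral (fun x => ((u x) ^+ 2)%:E))// => x _ /=.
by rewrite ger0_norm// sqr_ge0.
Qed.

Lemma integrable_inL2 u : measurable_fun setT u ->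
  integr (fun x => u x ^+ 2) -> inL2 mu u.
Proof.
move=> mu_ /integrableP[_ ioo]; split=> //.
rewrite /sqL2 (eq_integral (fun x => `|((u x) ^+ 2)%:E|%E))// => x _ /=.
by rewrite ger0_norm// sqr_ge0.
Qed.

Lemma inL2_mul u v : inL2 mu u -> inL2 mu v -> integr (fun x => u x * v x).
Proof.
move=> u2 v2; have mu_ := u2.1; have mv := v2.1.
apply: (@integrable_le _ (fun x => u x ^+ 2 + v x ^+ 2)).
- exact: measurable_funM.
- move=> x; rewrite normrM -(real_normK (num_real (u x))) -(real_normK (num_real (v x))).
  by have := sqr_ge0 (`|u x| - `|v x|); have := normr_ge0 (u x);
     have := normr_ge0 (v x); nra.
- by apply: integrable_add; apply: inL2_integrable.
Qed.

Lemma inL2D c u v : inL2 mu u -> inL2 mu v -> inL2 mu (fun x => u x + c * v x).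
Proof.
move=> u2 v2; have mu_ := u2.1; have mv := v2.1.
have m : measurable_fun setT (fun x => u x + c * v x).
  by apply: measurable_funD => //; apply: measurable_funM.
apply: integrable_inL2 => //.
apply: (@integrable_le _ (fun x => 2 * u x ^+ 2 + (2 * c ^+ 2) * v x ^+ 2)).
- exact: measurable_funX.
- by move=> x; rewrite ger0_norm ?sqr_ge0//; have := sqr_ge0 (u x - c * v x); nra.
- by apply: integrable_add; apply: integrable_scale; apply: inL2_integrable.
Qed.

Lemma inL2Z c u : inL2 mu u -> inL2 mu (fun x => c * u x).
Proof.
move=> u2; have mu_ := u2.1; apply: integrable_inL2; first exact: measurable_funM.
rewrite (_ : (fun x => _) = fun x => c ^+ 2 * u x ^+ 2); last first.
  by apply/funext => x; rewrite exprMn.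
by apply: integrable_scale; apply: inL2_integrable.
Qed.

Lemma inL2_add u v : inL2 mu u -> inL2 mu v -> inL2 mu (fun x => u x + v x).
Proof.
move=> u2 v2; have := @inL2D 1 u v u2 v2.
by rewrite (_ : (fun x => u x + 1 * v x) = fun x => u x + v x)//;
  apply/funext => x; rewrite mul1r.
Qed.

Lemma inL2_sub u v : inL2 mu u -> inL2 mu v -> inL2 mu (fun x => u x - v x).
Proof.
move=> u2 v2; have := @inL2D (-1) u v u2 v2.
by rewrite (_ : (fun x => u x + -1 * v x) = fun x => u x - v x)//;
  apply/funext => x; rewrite mulN1r.
Qed.

Lemma inL2_bounded u (B : R) : measurable_fun setT u ->
  (forall x, `|u x| <= B) -> inL2 mu u.
Proof.
move=> mu_ uB; apply: integrable_inL2 => //.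
apply: (@integrable_le _ (fun=> B ^+ 2)); [exact: measurable_funX| |exact: integrable_cst].
move=> x; rewrite normrX ler_pXn2r ?nnegrE//; exact: le_trans (uB x).
Qed.

Lemma inL2_sum (n : nat) (u_ : nat -> X -> R) : (forall i, inL2 mu (u_ i)) ->
  inL2 mu (fun x => \sum_(i < n) u_ i x).
Proof.
move=> h; elim: n => [|n ih].
  apply: (@inL2_bounded _ 0) => [|x]; last by rewrite big_ord0 normr0.
  rewrite (_ : (fun x => _) = cst 0)//; apply/funext => x; by rewrite big_ord0.
under eq_fun do rewrite big_ord_recr.
exact: inL2_add.
Qed.

Local Notation ip := (ipL2 mu).

Lemma ipE u v : ip u v = \int[mu]_x (u x * v x).
Proof. by []. Qed.

Lemma ipC u v : ip u v = ip v u.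
Proof. by rewrite !ipE; apply: eq_Rintegral => x _; rewrite mulrC. Qed.

Lemma ipDl c u v w : inL2 mu u -> inL2 mu v -> inL2 mu w ->
  ip (fun x => u x + c * v x) w = ip u w + c * ip v w.
Proof.
move=> u2 v2 w2; rewrite !ipE -Rintegral_lin; [|exact: inL2_mul|exact: inL2_mul].
by apply: eq_Rintegral => x _; ring.
Qed.

Lemma ipDr c u v w : inL2 mu u -> inL2 mu v -> inL2 mu w ->
  ip w (fun x => u x + c * v x) = ip w u + c * ip w v.
Proof. by move=> u2 v2 w2; rewrite ipC ipDl// !(ipC w). Qed.

Lemma ipZl c u v : inL2 mu u -> inL2 mu v -> ip (fun x => c * u x) v = c * ip u v.
Proof.
move=> u2 v2; rewrite !ipE -RintegralZl//; last exact: inL2_mul.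
by apply: eq_Rintegral => x _; ring.
Qed.

Lemma ip_suml n (u_ : nat -> X -> R) w : (forall i, inL2 mu (u_ i)) -> inL2 mu w ->
  ip (fun x => \sum_(i < n) u_ i x) w = \sum_(i < n) ip (u_ i) w.
Proof.
move=> h w2; elim: n => [|n ih].
  rewrite big_ord0 -[RHS](Rintegral_cst1 0) ipE.
  by apply: eq_Rintegral => x _; rewrite big_ord0 mul0r.
rewrite big_ord_recr -ih /= -[ip (u_ n) w]mul1r -ipDl//; last exact: inL2_sum.
by rewrite !ipE; apply: eq_Rintegral => x _; rewrite big_ord_recr /= mul1r.
Qed.

Lemma ip_ge0 u : 0 <= ip u u.
Proof. by apply: Rintegral_ge0 => x _; rewrite -expr2 sqr_ge0. Qed.

Lemma sqL2_ip u : inL2 mu u -> sqL2 mu u = (ip u u)%:E.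
Proof.
move=> u2; rewrite /sqL2 /ipL2 fineK.
  by apply: eq_integral => x _; rewrite expr2.
by have := integrable_fin_num measurableT (inL2_mul u2 u2).
Qed.

Lemma normL2_sqr u : inL2 mu u -> normL2 mu u ^+ 2 = ip u u.
Proof.
by move=> u2; rewrite /normL2 sqL2_ip//= sqr_sqrtr// ip_ge0.
Qed.

Lemma ip_CS u v : inL2 mu u -> inL2 mu v -> ip u v ^+ 2 <= ip u u * ip v v.
Proof.
move=> u2 v2.
rewrite mulrC; apply: discriminant_le => [|c]; first exact: ip_ge0.
have := ip_ge0 (fun x => u x + c * v x).
rewrite ipDl//; last exact: inL2D.
by rewrite !ipDr// (ipC v u); congr (0 <= _); ring.
Qed.

End SquareIntegrable.

(** * Fubini and kernel combinations *)

Section Fubini.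
Context {R : realType}.

(** No integrability is assumed: the integrals of the positive and negative parts are measurable in
    the parameter by Tonelli, and so is [fine] of their difference. *)
Lemma measurable_fun_param_Rintegral d d' (O : measurableType d) (X : measurableType d')
    (mu : probability X R) (F : O * X -> R) : measurable_fun setT F ->
  measurable_fun setT (fun w => \int[mu]_x F (w, x)).
Proof.
move=> mF; apply: measurableT_comp => //.
have -> : (fun w => (\int[mu]_x (F (w, x))%:E)%E) =
    (fun w => (\int[mu]_x ((EFin \o F)^\+ (w, x)) - \int[mu]_x ((EFin \o F)^\- (w, x)))%E).
  apply/funext => w; rewrite integralE; congr (_ - _)%E; apply: eq_integral => x _.
    by rewrite !funeposE.
  by rewrite !funenegE.
have h (G : O * X -> \bar R) : measurable_fun setT G -> (forall z, (0 <= G z)%E) ->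
    measurable_fun setT (fun w => (\int[mu]_x G (w, x))%E).
  by move=> mG G0; exact: (measurable_fun_fubini_tonelli_F G mG G0).
have mF' : measurable_fun setT (EFin \o F) by exact/measurable_EFinP.
by apply: emeasurable_funB; apply: h => //;
  [exact: measurable_funepos|exact: measurable_funeneg].
Qed.

(** A bound of the form [g x + h y] fits products u(y) v(x) K(y, x), dominated through squares. It
    makes every section integrable, not merely almost every one, so the inner integrals are finite
    pointwise. *)
Lemma Rintegral_exchange d (X : measurableType d) (mu : probability X R)
    (F : X * X -> R) (g h : X -> R) : measurable_fun setT F ->
  (forall x y, `|F (x, y)| <= g x + h y) ->
  mu.-integrable setT (EFin \o g) -> mu.-integrable setT (EFin \o h) ->
  \int[mu]_x (\int[mu]_y F (x, y)) = \int[mu]_y (\int[mu]_x F (x, y)).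
Proof.
move=> mF Fgh gi hi.
have mg := integrable_measurable gi; have mh := integrable_measurable hi.
have inx x : mu.-integrable setT (EFin \o (fun y => F (x, y))).
  apply: (@integrable_le _ _ _ mu _ (fun y => g x + h y)) => //.
    exact: measurableT_comp.
  by apply: integrable_add => //; exact: integrable_cst.
have iny y : mu.-integrable setT (EFin \o (fun x => F (x, y))).
  apply: (@integrable_le _ _ _ mu _ (fun x => g x + h y)) => //.
    exact: measurableT_comp.
  by apply: integrable_add => //; exact: integrable_cst.
have iF : (mu \x mu)%E.-integrable setT (EFin \o F).
  apply/integrable12ltyP; first exact/measurable_EFinP.
  apply: (@le_lt_trans _ _ (\int[mu]_x ((\int[mu]_y (g x + h y))%R)%:E)%E).
    apply: ge0_le_integral => //.
    - by move=> x _; apply: integral_ge0 => y _; exact: abse_ge0.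
    - apply: (@measurable_fun_fubini_tonelli_F _ _ _ _ _ mu (abse \o (EFin \o F))).
        by apply: measurableT_comp => //; exact/measurable_EFinP.
      by move=> z; exact: abse_ge0.
    - apply/measurable_EFinP.
      apply: (@measurable_fun_param_Rintegral _ _ _ _ mu (fun z => g z.1 + h z.2)).
      by apply: measurable_funD; apply: measurableT_comp.
    - move=> x _; rewrite [leRHS]fineK; last first.
        by have := integrable_fin_num measurableT
             (integrable_add (integrable_cst mu (g x)) hi).
      apply: ge0_le_integral => //.
      + by apply: measurableT_comp => //; exact: measurable_int (inx x).
      + by apply/measurable_EFinP; exact: measurable_funD.
      + by move=> y _; rewrite lee_fin.
  have gh : mu.-integrable setT (EFin \o (fun x => \int[mu]_y (g x + h y))).
    rewrite (_ : (fun x => _) = fun x => g x + \int[mu]_y h y).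
      by apply: integrable_add => //; exact: integrable_cst.
    apply/funext => x; rewrite RintegralD//; last exact: integrable_cst.
    by rewrite Rintegral_cst1.
  have := integrable_fin_num measurableT gh.
  by rewrite fin_numElt => /andP[].
have := Fubini iF; rewrite /= => E.
rewrite /Rintegral; congr fine.
transitivity (\int[mu]_x \int[mu]_y (F (x, y))%:E)%E.
  apply: eq_integral => x _; rewrite fineK//.
  by have := integrable_fin_num measurableT (inx x).
rewrite E; apply: eq_integral => y _; rewrite fineK//.
by have := integrable_fin_num measurableT (iny y).
Qed.

End Fubini.

Section KernelCombinations.
Context {R : realType} {d : measure_display} {T : measurableType d}.
Variable K : T -> T -> R.
Hypothesis Ksym : forall x x', K x x' = K x' x.
Hypothesis Kpsd : psd_kernel K.

(* The list [:: (c_1, x_1); ...; (c_n, x_n)] encodes c_1 K_{x_1} + ... + c_n K_{x_n}. *)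
Definition kcomb (s : seq (R * T)) (x : T) : R := \sum_(p <- s) p.1 * K p.2 x.

(** The squared RKHS norm, attached to the list and not to the function it represents, so
    independence of the representation never has to be shown. *)
Definition knorm2 (s : seq (R * T)) : R := \sum_(p <- s) p.1 * kcomb s p.2.

Lemma kcomb_cons c x s y : kcomb ((c, x) :: s) y = c * K x y + kcomb s y.
Proof. by rewrite /kcomb big_cons. Qed.

Lemma knorm2_cons c x s :
  knorm2 ((c, x) :: s) = c ^+ 2 * K x x + 2 * c * kcomb s x + knorm2 s.
Proof.
rewrite /knorm2 big_cons kcomb_cons /=.
under eq_bigr do rewrite kcomb_cons mulrDr.
rewrite big_split /=.
have -> : \sum_(p <- s) p.1 * (c * K x p.2) = c * kcomb s x.
  by rewrite /kcomb mulr_sumr; apply: eq_bigr => p _; rewrite Ksym; ring.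
ring.
Qed.

Lemma knorm2_ge0 s : 0 <= knorm2 s.
Proof.
have := Kpsd (fun i : 'I_(size s) => (tnth (in_tuple s) i).2)
             (fun i : 'I_(size s) => (tnth (in_tuple s) i).1).
congr (0 <= _); rewrite /knorm2 /kcomb [RHS]big_tnth; apply: eq_bigr => i _.
rewrite [in RHS]big_tnth mulr_sumr; apply: eq_bigr => j _.
by rewrite Ksym; ring.
Qed.

Lemma kdiag_ge0 x : 0 <= K x x.
Proof.
by have := knorm2_ge0 [:: (1, x)];
  rewrite knorm2_cons /knorm2 /kcomb !big_nil mulr0 !addr0 expr1n mul1r.
Qed.

(** Cauchy-Schwarz for <f, K_x>_K: the squared norm of c K_x + f is a nonnegative quadratic in c. *)
Lemma kcomb_le s x : kcomb s x ^+ 2 <= K x x * knorm2 s.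
Proof.
apply: discriminant_le => [|c]; first exact: kdiag_ge0.
by rewrite -knorm2_cons knorm2_ge0.
Qed.

Lemma kernel_le (k2 : R) : (forall x, K x x <= k2) -> forall x y, `|K x y| <= k2.
Proof.
move=> Kk x y.
have := kcomb_le [:: (1, x)] y.
rewrite kcomb_cons knorm2_cons /knorm2 /kcomb !big_nil mulr0 !addr0 expr1n !mul1r => H.
have k0 : 0 <= k2 := le_trans (kdiag_ge0 x) (Kk x).
rewrite -(ler_pXn2r (n := 2))// ?nnegrE// real_normK ?num_real//.
apply: le_trans H _; rewrite expr2; apply: ler_pM => //; exact: kdiag_ge0.
Qed.

End KernelCombinations.

(** * The integral operator and its positivity *)

Lemma measurable_fun2_comp {R : realType} d1 d2 d3 (A : measurableType d1)
    (B : measurableType d2) (T : measurableType d3) (F : A -> B -> R) (f : T -> A) (g : T -> B) :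
  measurable_fun setT (fun z : A * B => F z.1 z.2) ->
  measurable_fun setT f -> measurable_fun setT g ->
  measurable_fun setT (fun t => F (f t) (g t)).
Proof. by move=> mF mf mg; exact: (measurableT_comp mF (measurable_fun_pair mf mg)). Qed.

Section IntegralOperator.
Context {R : realType} {d : measure_display} {X : measurableType d}.
Variables (mu : probability X R) (K : X -> X -> R) (k2 : R).
Hypothesis mK : measurable_fun setT (fun xy : X * X => K xy.1 xy.2).
Hypothesis Ksym : forall x x', K x x' = K x' x.
Hypothesis Kpsd : psd_kernel K.
Hypothesis Kk : forall x, K x x <= k2.

Local Notation ip := (ipL2 mu).
Local Notation L := (LK mu K).
Local Notation "'L2'" := (inL2 mu).

Lemma measurable_kernel_section x : measurable_fun setT (K x).
Proof.
exact: (measurable_fun2_comp mK (f := fun=> x) (g := id)).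
Qed.

Lemma kernel_section_inL2 x : L2 (K x).
Proof.
apply: (@inL2_bounded _ _ _ _ _ k2); first exact: measurable_kernel_section.
by move=> y; apply: kernel_le.
Qed.

Lemma LKE u x : L u x = ip u (K x).
Proof. by rewrite ipE /LK; apply: eq_Rintegral => y _; rewrite Ksym. Qed.

Lemma LKD c u v : L2 u -> L2 v ->
  L (fun x => u x + c * v x) = (fun x => L u x + c * L v x).
Proof.
move=> u2 v2; apply/funext => x; rewrite !LKE ipDl//; exact: kernel_section_inL2.
Qed.

Lemma measurable_LK_param d' (O : measurableType d') (f : O -> X -> R) :
  measurable_fun setT (fun wx : O * X => f wx.1 wx.2) ->
  measurable_fun setT (fun wx : O * X => L (f wx.1) wx.2).
Proof.
move=> mf.
apply: (@measurable_fun_param_Rintegral _ _ _ (O * X)%type X mu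
  (fun wxy => f wxy.1.1 wxy.2 * K wxy.2 wxy.1.2)).
apply: measurable_funM.
  by apply: (measurable_fun2_comp mf) => //; exact: measurableT_comp.
by apply: (measurable_fun2_comp mK) => //; exact: measurableT_comp.
Qed.

Lemma measurable_LK u : L2 u -> measurable_fun setT (L u).
Proof.
move=> [mu_ _].
(* A one-point parameter space reduces a single function to the case of a family. *)
have h : measurable_fun setT (fun wx : unit * X => L u wx.2).
  apply: (@measurable_LK_param _ unit (fun _ => u)); exact: measurableT_comp.
exact: (measurable_fun2_comp (F := fun _ => L u) h (f := fun=> tt) (g := id)).
Qed.

Let k2_ge0 (x : X) : 0 <= k2.
Proof. exact: le_trans (kdiag_ge0 Ksym Kpsd x) (Kk x). Qed.

Lemma ip_kernel_section_le x : ip (K x) (K x) <= k2 ^+ 2.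
Proof.
rewrite -[leRHS](Rintegral_cst1 mu); apply: Rintegral_mono.
- by apply: inL2_mul; exact: kernel_section_inL2.
- exact: integrable_cst.
- move=> y; rewrite -expr2 -real_normK ?num_real// ler_pXn2r ?nnegrE ?k2_ge0//.
  exact: kernel_le.
Qed.

(** Cauchy-Schwarz bounds the square; t <= 1 + t^2 then avoids a square root, the exact constant
    being irrelevant. *)
Lemma LK_bounded u x : L2 u -> `|L u x| <= 1 + ip u u * k2 ^+ 2.
Proof.
move=> u2; have := ip_CS u2 (kernel_section_inL2 x); rewrite -LKE => H.
have H2 : L u x ^+ 2 <= ip u u * k2 ^+ 2.
  by apply: le_trans H _; rewrite ler_wpM2l ?ip_ge0// ip_kernel_section_le.
rewrite -(real_normK (num_real (L u x))) in H2; have := normr_ge0 (L u x).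
by nra.
Qed.

Lemma LK_inL2 u : L2 u -> L2 (L u).
Proof.
move=> u2; apply: (@inL2_bounded _ _ _ _ _ (1 + ip u u * k2 ^+ 2)).
  exact: measurable_LK.
by move=> x; exact: LK_bounded.
Qed.

Lemma LK_selfadjoint u v : L2 u -> L2 v -> ip (L u) v = ip u (L v).
Proof.
move=> u2 v2; have [mu_ _] := u2; have [mv _] := v2.
pose F (z : X * X) := v z.1 * (u z.2 * K z.2 z.1).
have -> : ip (L u) v = \int[mu]_x (\int[mu]_y F (x, y)).
  rewrite ipE; apply: eq_Rintegral => x _.
  rewrite mulrC LKE ipE -RintegralZl//; last exact: inL2_mul u2 (kernel_section_inL2 x).
  by apply: eq_Rintegral => y _; rewrite /F/= Ksym.
have -> : ip u (L v) = \int[mu]_y (\int[mu]_x F (x, y)).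
  rewrite ipE; apply: eq_Rintegral => y _.
  rewrite LKE ipE -RintegralZl//; last exact: inL2_mul v2 (kernel_section_inL2 y).
  by apply: eq_Rintegral => x _; rewrite /F/=; ring.
apply: (@Rintegral_exchange _ _ _ _ _ (fun x => k2 * v x ^+ 2) (fun x => k2 * u x ^+ 2)).
- apply: measurable_funM; first exact: measurableT_comp.
  apply: measurable_funM; first exact: measurableT_comp.
  exact: (measurable_fun2_comp mK).
- move=> x y; rewrite /F/= !normrM mulrA -mulrDr mulrC.
  apply: ler_pM => //; first exact: kernel_le.
  rewrite -(real_normK (num_real (u y))) -(real_normK (num_real (v x))).
  by have := sqr_ge0 (`|u y| - `|v x|); have := normr_ge0 (u y);
     have := normr_ge0 (v x); nra.
- by apply: integrable_scale; exact: inL2_integrable.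
- by apply: integrable_scale; exact: inL2_integrable.
Qed.

(* Positivity on finite combinations passes to s + n (u mu): spend the induction
   hypothesis on (u x, x) :: s and integrate over x.  The diagonal term stays
   linear in n, so it disappears after rescaling u by 1/n. *)
Lemma kernel_positive_aux n u (s : seq (R * X)) : L2 u ->
  0 <= knorm2 K s + 2 * n%:R * (\sum_(p <- s) p.1 * L u p.2)
       + n%:R * (n%:R - 1) * ip u (L u) + n%:R * \int[mu]_x (u x ^+ 2 * K x x).
Proof.
move=> u2; have [mu_ _] := u2; elim: n s => [|n ih] s.
  by rewrite mulr0 !mul0r !addr0; exact: knorm2_ge0.
pose c := knorm2 K s + 2 * n%:R * (\sum_(p <- s) p.1 * L u p.2)
       + n%:R * (n%:R - 1) * ip u (L u) + n%:R * \int[mu]_x (u x ^+ 2 * K x x).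
(* [f x] is the induction hypothesis at [(u x, x) :: s]. Its last term integrates to 2 n <u, L u>,
   the difference between (n + 1) n and n (n - 1) copies. *)
pose f x := c + (u x ^+ 2 * K x x) + (2 * (u x * kcomb K s x)) + 2 * n%:R * (u x * L u x).
have f0 x : 0 <= f x.
  have := ih ((u x, x) :: s); rewrite knorm2_cons// big_cons /=.
  by congr (0 <= _); rewrite /f /c; ring.
have mdiag : measurable_fun setT (fun x => K x x).
  exact: (measurable_fun2_comp mK).
have i1 : mu.-integrable setT (EFin \o (fun x => u x ^+ 2 * K x x)).
  apply: (integrable_le (g := fun x => k2 * u x ^+ 2)).
  - by apply: measurable_funM => //; exact: measurable_funX.
  - move=> x; rewrite normrM mulrC ger0_norm ?kdiag_ge0//.
    by rewrite ger0_norm ?sqr_ge0// ler_wpM2r ?sqr_ge0.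
  - by apply: integrable_scale; exact: inL2_integrable.
have i2' t : mu.-integrable setT (EFin \o (fun x => u x * kcomb K t x)) /\
    \int[mu]_x (u x * kcomb K t x) = \sum_(p <- t) p.1 * L u p.2.
  elim: t => [|[b y] t [ii ie]].
    rewrite /kcomb big_nil; split.
      rewrite (_ : (fun x => _) = fun=> 0); first exact: integrable_cst.
      by apply/funext => x; rewrite big_nil mulr0.
    rewrite -[RHS](Rintegral_cst1 mu 0); apply: eq_Rintegral => x _.
    by rewrite big_nil mulr0.
  have E : (fun x => u x * kcomb K ((b, y) :: t) x) =
      fun x => u x * kcomb K t x + b * (u x * K y x).
    by apply/funext => x; rewrite kcomb_cons; ring.
  have iy := inL2_mul u2 (kernel_section_inL2 y).
  rewrite E; split; first by apply: integrable_add => //; exact: integrable_scale.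
  by rewrite Rintegral_lin// ie big_cons LKE addrC.
have [i2 e2] := i2' s.
have i3 := inL2_mul u2 (LK_inL2 u2).
have : 0 <= \int[mu]_x f x by apply: Rintegral_ge0 => x _.
rewrite Rintegral_lin//; last first.
  apply: integrable_add; last exact: integrable_scale.
  by apply: integrable_add => //; exact: integrable_cst.
rewrite Rintegral_lin//; last by apply: integrable_add => //; exact: integrable_cst.
rewrite RintegralD//; last exact: integrable_cst.
rewrite Rintegral_cst1 e2 -(ipE mu u (L u)); congr (0 <= _); rewrite /c -[n.+1]addn1 natrD; ring.
Qed.

(** This is the squared RKHS norm of c K_x + L w, since L w is the integral of w(y) K_y and has
    squared norm <w, L w>. With w / n in place of w, [kernel_positive_aux] yields the expression
    plus a defect (D - <w, L w>) / n, which vanishes for large n. *)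
Lemma kernel_positive c x w : L2 w ->
  0 <= c ^+ 2 * K x x + 2 * c * L w x + ip w (L w).
Proof.
move=> w2; rewrite leNgt; apply/negP => neg.
set A := c ^+ 2 * _ + _ + _ in neg.
set D := \int[mu]_y (w y ^+ 2 * K y y).
(* [e] bounds the numerator of the defect; once n > e / (- A), the defect cannot compensate a
   negative [A]. *)
pose e := `|D| + `|ip w (L w)|.
have [n] : exists n : nat, e / - A < n%:R.
  by exists (Num.truncn (e / - A)).+1; exact: truncnS_gt.
have Ap : 0 < - A by rewrite oppr_gt0.
rewrite ltr_pdivrMr// => en.
have n0 : (0 < n)%N.
  case: n en => // ; rewrite mul0r ltNge /e; by rewrite addr_ge0.
have n0' : 0 < n%:R :> R by rewrite ltr0n.
have w2' : L2 (fun y => n%:R^-1 * w y) by exact: inL2Z.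
have Lz : L (fun y => n%:R^-1 * w y) = fun y => n%:R^-1 * L w y.
  by apply/funext => y; rewrite !LKE ipZl//; exact: kernel_section_inL2.
have := kernel_positive_aux n [:: (c, x)] w2'.
rewrite knorm2_cons// /knorm2 /kcomb !big_nil big_cons big_nil mulr0 !addr0 /= Lz.
rewrite ipZl//; last by apply: inL2Z; exact: LK_inL2.
rewrite [ip w _]ipC ipZl//; last exact: LK_inL2.
rewrite [ip (L w) w]ipC.
have -> : \int[mu]_y ((n%:R^-1 * w y) ^+ 2 * K y y) = n%:R^-1 ^+ 2 * D.
  rewrite /D -RintegralZl//.
    by apply: eq_Rintegral => y _; ring.
  apply: (integrable_le (g := fun x => k2 * w x ^+ 2)).
  - apply: measurable_funM; first by apply: measurable_funX; case: w2.
    exact: (measurable_fun2_comp mK).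
  - move=> y; rewrite normrM mulrC ger0_norm ?kdiag_ge0//.
    by rewrite ger0_norm ?sqr_ge0// ler_wpM2r ?sqr_ge0.
  - by apply: integrable_scale; exact: inL2_integrable.
rewrite (_ : _ + _ = A + (D - ip w (L w)) / n%:R); last first.
  by rewrite /A; field; rewrite gt_eqF.
rewrite leNgt => /negP; apply.
rewrite -ltrBrDl sub0r ltr_pdivrMr// mulrC; apply: le_lt_trans en.
by rewrite /e (le_trans (ler_norm _))// ler_normB.
Qed.

End IntegralOperator.

(** * Smoothing by powers of 1 - a L_K *)

Section Smoothing.
Context {R : realType} {d : measure_display} {X : measurableType d}.
Variables (mu : probability X R) (K : X -> X -> R) (k2 a : R).
Hypothesis mK : measurable_fun setT (fun xy : X * X => K xy.1 xy.2).
Hypothesis Ksym : forall x x', K x x' = K x' x.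
Hypothesis Kpsd : psd_kernel K.
Hypothesis Kk : forall x, K x x <= k2.
Hypothesis a_gt0 : 0 < a.
Hypothesis ak2 : a * k2 <= 1.

Local Notation ip := (ipL2 mu).
Local Notation L := (LK mu K).
Local Notation "'L2'" := (inL2 mu).
Local Notation LKL2 := (LK_inL2 mK Ksym Kpsd Kk).
Local Notation sectionL2 := (kernel_section_inL2 mu mK Ksym Kpsd Kk).

Lemma probability_inhabited : exists x : X, True.
Proof.
apply: contrapT => h; have := probability_setT mu.
rewrite (_ : setT = set0) ?measure0; first by move=> /eqP; rewrite eq_sym onee_eq0.
by apply/seteqP; split => // x _; apply: h; exists x.
Qed.

Lemma LK_form_ge0 w : L2 w -> 0 <= ip w (L w).
Proof.
move=> w2; have [x _] := probability_inhabited.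
by have := kernel_positive mK Ksym Kpsd Kk 0 x w2; rewrite expr0n mulr0 !mul0r !add0r.
Qed.

Let k2_ge0 : 0 <= k2.
Proof.
by have [x _] := probability_inhabited; exact: le_trans (kdiag_ge0 Ksym Kpsd x) (Kk x).
Qed.

(** Cauchy-Schwarz in the RKHS between K_x and L w, read off the quadratic in c of
    [kernel_positive]. *)
Lemma LK_sqr_le w x : L2 w -> L w x ^+ 2 <= k2 * ip w (L w).
Proof.
move=> w2; apply: (@le_trans _ _ (K x x * ip w (L w))).
  apply: discriminant_le => [|c]; first exact: kdiag_ge0.
  exact: (kernel_positive mK Ksym Kpsd Kk).
by rewrite ler_wpM2r// LK_form_ge0.
Qed.

Lemma LK_norm_le w : L2 w -> ip (L w) (L w) <= k2 * ip w (L w).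
Proof.
move=> w2; have Lw2 := LKL2 w2.
rewrite -[leRHS](Rintegral_cst1 mu); apply: Rintegral_mono.
- exact: inL2_mul.
- exact: integrable_cst.
- by move=> x; rewrite -expr2 LK_sqr_le.
Qed.

(** Cauchy-Schwarz and [LK_norm_le] give <w, L w>^2 <= |w|^2 k2 <w, L w>, and one factor cancels. *)
Lemma LK_form_le w : L2 w -> ip w (L w) <= k2 * ip w w.
Proof.
move=> w2; have Lw2 := LKL2 w2.
have := ip_CS w2 Lw2; have := LK_norm_le w2; have := LK_form_ge0 w2; have := ip_ge0 mu w.
move: k2_ge0; set A := ip w w; set B := ip w (L w); set C := ip (L w) (L w) => k0 A0 B0 CB BB.
have [->|Bn0] := eqVneq B 0; first exact: mulr_ge0.
have Bp : 0 < B by rewrite lt_def Bn0.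
rewrite -(ler_pM2r Bp) -expr2; apply: le_trans BB _.
by rewrite -mulrA mulrCA ler_wpM2l.
Qed.

Definition contraction (u : X -> R) : X -> R := fun x => u x - a * L u x.

Local Notation P := contraction.

Lemma contractionE u : P u = fun x => u x + (- a) * L u x.
Proof. by apply/funext => x; rewrite /P mulNr. Qed.

Lemma contraction_inL2 u : L2 u -> L2 (P u).
Proof. by move=> u2; rewrite contractionE; apply: inL2D => //; exact: LKL2. Qed.

Lemma iter_contraction_inL2 k u : L2 u -> L2 (iter k P u).
Proof. by move=> u2; elim: k => //= k; exact: contraction_inL2. Qed.

Lemma contractionD c u v : L2 u -> L2 v ->
  P (fun x => u x + c * v x) = (fun x => P u x + c * P v x).
Proof.
move=> u2 v2; apply/funext => x; rewrite /P (LKD mK Ksym Kpsd Kk)//; ring.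
Qed.

Lemma iter_contractionD k c u v : L2 u -> L2 v ->
  iter k P (fun x => u x + c * v x) = (fun x => iter k P u x + c * iter k P v x).
Proof.
move=> u2 v2; elim: k => //= k ->; rewrite contractionD//; exact: iter_contraction_inL2.
Qed.

Lemma contraction_selfadjoint u v : L2 u -> L2 v -> ip (P u) v = ip u (P v).
Proof.
move=> u2 v2; rewrite !contractionE ipDl ?ipDr//; try exact: LKL2.
by rewrite (LK_selfadjoint mK Ksym Kpsd Kk).
Qed.

Lemma iter_contraction_selfadjoint k u v : L2 u -> L2 v ->
  ip (iter k P u) v = ip u (iter k P v).
Proof.
elim: k u v => // k ih u v u2 v2; rewrite iterS contraction_selfadjoint//.
  by rewrite ih// -?iterSr//; exact: contraction_inL2.
exact: iter_contraction_inL2.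
Qed.

Lemma LK_contraction u : L2 u -> L (P u) = P (L u).
Proof.
move=> u2; rewrite {1}contractionE (LKD mK Ksym Kpsd Kk)//; last exact: LKL2.
by apply/funext => x; rewrite /P mulNr.
Qed.

Lemma LK_iter_contraction k u : L2 u -> L (iter k P u) = iter k P (L u).
Proof.
move=> u2; elim: k => //= k <-; rewrite LK_contraction//; exact: iter_contraction_inL2.
Qed.

Lemma ip_contraction u : L2 u ->
  ip (P u) (P u) = ip u u - 2 * a * ip u (L u) + a ^+ 2 * ip (L u) (L u).
Proof.
move=> u2; have Lu2 := LKL2 u2; rewrite !contractionE ipDl//; last exact: inL2D.
by rewrite !ipDr// (ipC mu (L u) u); ring.
Qed.

Lemma ip_contraction_le u : L2 u -> ip (P u) (P u) <= ip u u.
Proof.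
move=> u2; rewrite ip_contraction//.
have := LK_norm_le u2; have := LK_form_ge0 u2.
set B := ip u (L u); set C := ip (L u) (L u) => B0 CB.
have : a ^+ 2 * C <= a * B.
  rewrite expr2 -mulrA ler_wpM2l ?(ltW a_gt0)//; apply: (@le_trans _ _ (a * k2 * B)).
    by rewrite -mulrA ler_wpM2l// ltW.
  by rewrite ler_piMl.
by have := mulr_ge0 (ltW a_gt0) B0; lra.
Qed.

(** The left side is what averaging one update leaves apart from its quadratic term; this converts
    it into the norm with one more power of [P]. *)
Lemma ip_contraction_ge u : L2 u -> ip u u - 2 * a * ip u (L u) <= ip (P u) (P u).
Proof.
by move=> u2; rewrite ip_contraction// lerDl mulr_ge0 ?sqr_ge0// ip_ge0.
Qed.

(* With v_j = P^j K_x = K_x - L w_j, the squared RKHS norm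
   N_j = K(x,x) - 2 (L w_j)(x) + <w_j, L w_j> of v_j is nonnegative and drops by at
   least a |v_j|^2 at each step, while |v_j| is nonincreasing. *)
Definition residual_energy x w := K x x - 2 * L w x + ip w (L w).

Lemma residual_energy_ge0 x w : L2 w -> 0 <= residual_energy x w.
Proof.
move=> w2; have := kernel_positive mK Ksym Kpsd Kk (-1) x w2.
by congr (0 <= _); rewrite /residual_energy; ring.
Qed.

Lemma residual_energy_step x w v : L2 w -> v = (fun y => K x y - L w y) ->
  residual_energy x (fun y => w y + a * v y) + a * ip v v <= residual_energy x w.
Proof.
move=> w2 vE; have Lw2 := LKL2 w2.
have v2 : L2 v by rewrite vE; apply: inL2_sub => //; exact: sectionL2.
have Lv2 := LKL2 v2.
(* As K_x = v + L w, the value (L v)(x) = <v, K_x> splits into |v|^2 and a part that cancels the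
   cross terms. The energy thus changes by -2 a |v|^2 + a^2 <v, L v>. *)
have Lvx : L v x = ip v v + ip v (L w).
  rewrite LKE// [X in ip v X = _](_ : K x = fun y => v y + 1 * L w y); last first.
    by apply/funext => y; rewrite vE mul1r subrK.
  by rewrite ipDr// mul1r.
have wv : ip w (L v) = ip v (L w) by rewrite -(LK_selfadjoint mK Ksym Kpsd Kk)// ipC.
rewrite /residual_energy (LKD mK Ksym Kpsd Kk)// ipDl//; last exact: inL2D.
rewrite !ipDr// wv Lvx.
have := LK_form_le v2; set B := ip v (L v); have := ip_ge0 mu v; set A := ip v v => A0 BA.
have : a ^+ 2 * B <= a * A.
  rewrite expr2 -mulrA ler_wpM2l ?(ltW a_gt0)//; apply: (@le_trans _ _ (a * k2 * A)).
    by rewrite -mulrA ler_wpM2l// ltW.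
  by rewrite ler_piMl.
by lra.
Qed.

(** As |v_j| is nonincreasing, the energy drops for j = 0, ..., k add up to at least a (k + 1)
    |v_k|^2, while the initial energy is only K(x, x). *)
Lemma smoothing k x : ip (iter k P (K x)) (iter k P (K x)) <= k2 / (a * k.+1%:R).
Proof.
(* [w] starts at 0 and becomes w + a v_k, because P v_k = K_x - L (w + a v_k). The invariant counts
   k drops; the one taken after the induction supplies the factor k + 1. *)
have [w [w2 vE H]] : exists w, [/\ L2 w, iter k P (K x) = (fun y => K x y - L w y) &
    residual_energy x w + a * k%:R * ip (iter k P (K x)) (iter k P (K x)) <= K x x].
  elim: k => [|k [w [w2 vE H]]].
    have w2 : L2 (fun=> 0) by apply: (@inL2_bounded _ _ _ _ _ 0) => // y; rewrite normr0.
    have L0 y : L (fun=> 0) y = 0.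
      rewrite LKE// ipE -[RHS](Rintegral_cst1 mu); apply: eq_Rintegral => z _.
      by rewrite mul0r.
    exists (fun=> 0); split => //=.
      by apply/funext => y; rewrite L0 subr0.
    rewrite /residual_energy L0 !mulr0 mul0r subr0 addr0 ipE.
    rewrite (_ : \int[mu]_y _ = 0) ?addr0// -[RHS](Rintegral_cst1 mu).
    by apply: eq_Rintegral => z _; rewrite mul0r.
  have v2 : L2 (iter k P (K x)) by apply: iter_contraction_inL2; exact: sectionL2.
  exists (fun y => w y + a * iter k P (K x) y); split.
  - exact: inL2D.
  - rewrite iterS (LKD mK Ksym Kpsd Kk)//; apply/funext => y.
    by rewrite /P {1}vE; ring.
  - have := residual_energy_step w2 vE.
    have := ip_contraction_le v2; rewrite -iterS.
    set A' := ip _ _; set A := ip _ _ => A'A ES.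
    have : a * k.+1%:R * A' <= a * k.+1%:R * A by rewrite ler_wpM2l// mulr_ge0// ltW.
    by move: H; rewrite -/A -[k.+1]addn1 natrD; lra.
have v2 : L2 (iter k P (K x)) by apply: iter_contraction_inL2; exact: sectionL2.
have := residual_energy_step w2 vE.
have := residual_energy_ge0 x (inL2D a w2 v2).
set A := ip _ _ in H * => N0 ES.
rewrite ler_pdivlMr; last by rewrite mulr_gt0// ltr0n.
by have := Kk x; move: H; rewrite -[k.+1]addn1 natrD; lra.
Qed.

End Smoothing.

(** * Spectral bound on the bias *)

Section SquareIntegrableConvergence.
Context {R : realType} {d : measure_display} {X : measurableType d}.
Variable mu : probability X R.

(** A single index at finite distance suffices: u = (u - u_n) + u_n. *)
Lemma sqL2_cvg_inL2 (u : X -> R) (u_ : nat -> X -> R) : measurable_fun setT u ->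
  (forall n, inL2 mu (u_ n)) ->
  (fun n => sqL2 mu (fun x => u x - u_ n x)) @ \oo --> 0%E -> inL2 mu u.
Proof.
move=> mu_ u2 /fine_cvgP[[n _ fin] _].
have dL2 : inL2 mu (fun x => u x - u_ n x).
  split; first by apply: measurable_funB => //; case: (u2 n).
  by have := fin n (leqnn n); rewrite fin_numElt => /andP[].
by have := inL2_add dL2 (u2 n); rewrite (_ : (fun x => _) = u)//;
  apply/funext => x; rewrite subrK.
Qed.

Lemma sqL2_cvg_ip (u v : X -> R) (u_ : nat -> X -> R) : inL2 mu u -> inL2 mu v ->
  (forall n, inL2 mu (u_ n)) ->
  (fun n => sqL2 mu (fun x => u x - u_ n x)) @ \oo --> 0%E ->
  (fun n => ipL2 mu (u_ n) v) @ \oo --> ipL2 mu u v.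
Proof.
move=> u2 v2 u_2 /fine_cvgP[_ h].
pose D n := fun x => u x + (-1) * u_ n x.
have D2 n : inL2 mu (D n) by exact: inL2D.
have {}h : (fun n => ipL2 mu (D n) (D n)) @ \oo --> (0 : R).
  rewrite (_ : (fun n => _) = fine \o (fun n => sqL2 mu (fun x => u x - u_ n x)))//.
  apply/funext => n /=; rewrite (_ : (fun x => u x - u_ n x) = D n) ?sqL2_ip//.
  by apply/funext => x; rewrite /D mulN1r.
have {}h : (fun n => Num.sqrt (ipL2 mu (D n) (D n) * ipL2 mu v v)) @ \oo --> (0 : R).
  have h' : (fun n => ipL2 mu (D n) (D n) * ipL2 mu v v) @ \oo --> 0 * ipL2 mu v v.
    by apply: cvgM => //; exact: cvg_cst.
  rewrite mul0r in h'.
  rewrite -(@sqrtr0 R). exact: (continuous_cvg _ (@sqrt_continuous R 0) h').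
apply/cvgrPdist_le => e e0; near=> n.
have -> : ipL2 mu u v - ipL2 mu (u_ n) v = ipL2 mu (D n) v.
  by rewrite ipDl// mulN1r.
apply: (@le_trans _ _ (Num.sqrt (ipL2 mu (D n) (D n) * ipL2 mu v v))).
  by rewrite -sqrtr_sqr ler_wsqrtr// ip_CS.
near: n; move/cvgrPdist_le : h => /(_ _ e0); apply: filterS => n.
by rewrite sub0r normrN ger0_norm// sqrtr_ge0.
Unshelve. all: by end_near. Qed.

End SquareIntegrableConvergence.

(** With t = l a T / r, the left side is (r / (a T))^r times t^r (1 - a l)^T; the two last factors
    are at most exp(t r) and exp(- t r). *)
Lemma powR_mul_contraction_le {R : realType} (r a l : R) (T : nat) :
  0 < r -> 0 < a -> 0 < l -> a * l <= 1 -> (0 < T)%N ->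
  l `^ r * (1 - a * l) ^+ T <= (r / (a * T%:R)) `^ r.
Proof.
move=> r0 a0 l0 al1 T0; have T0' : 0 < T%:R :> R by rewrite ltr0n.
pose t := l * a * T%:R / r.
have t0 : 0 < t by rewrite /t divr_gt0// !mulr_gt0.
have -> : l = (r / (a * T%:R)) * t by rewrite /t; field; rewrite !gt_eqF.
rewrite powRM; [|by rewrite divr_ge0// ltW// mulr_gt0|exact: ltW].
rewrite -mulrA -[leRHS]mulr1 ler_wpM2l ?powR_ge0//.
have -> : r / (a * T%:R) * t = l by rewrite /t; field; rewrite !gt_eqF.
have h1 : (1 - a * l) ^+ T <= expR (- (t * r)).
  have -> : - (t * r) = (- (a * l)) * T%:R by rewrite /t; field; rewrite gt_eqF.
  rewrite expRM_natr ler_pXn2r// ?nnegrE ?expR_ge0// ?subr_ge0//.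
  exact: expR_ge1Dx.
have h2 : t `^ r <= expR (t * r).
  rewrite /powR gt_eqF// ler_expR mulrC ler_wpM2r// ?ltW//.
  by have := @expR_ge1Dx R (ln t); rewrite lnK ?posrE//; lra.
apply: (@le_trans _ _ (expR (t * r) * expR (- (t * r)))).
  by apply: ler_pM => //; [exact: powR_ge0|rewrite exprn_ge0// subr_ge0].
by rewrite -expRD subrr expR0.
Qed.

Section SpectralBias.
Context {R : realType} {d : measure_display} {X : measurableType d}.
Variables (mu : probability X R) (K : X -> X -> R) (k2 a : R).
Hypothesis mK : measurable_fun setT (fun xy : X * X => K xy.1 xy.2).
Hypothesis Ksym : forall x x', K x x' = K x' x.
Hypothesis Kpsd : psd_kernel K.
Hypothesis Kk : forall x, K x x <= k2.
Hypothesis a_gt0 : 0 < a.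
Hypothesis ak2 : a * k2 <= 1.

Local Notation ip := (ipL2 mu).
Local Notation L := (LK mu K).
Local Notation "'L2'" := (inL2 mu).
Local Notation LKL2 := (LK_inL2 mK Ksym Kpsd Kk).
Local Notation P := (contraction mu K a).

Variables (lam : nat -> R) (phi : nat -> X -> R).
Hypothesis spec : spectral_system mu K lam phi.

Let lam0 i : 0 <= lam i. Proof. by case: spec. Qed.
Let phi2 i : L2 (phi i). Proof. by case: spec. Qed.
Let ortho i j : lam i != 0 -> lam j != 0 -> ip (phi i) (phi j) = (i == j)%:R.
Proof. by case: spec => _ _ h _; exact: h. Qed.

(** Paired with [phi i], the partial sums are constant from n = i + 1 on. Padding functions need not
    be orthogonal to [phi i], hence the condition that their coefficients vanish. *)
Lemma spectral_coef (u : X -> R) (c : nat -> R) i : L2 u ->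
  (forall j, lam j = 0 -> c j = 0) ->
  (fun n => sqL2 mu (fun x => u x - \sum_(j < n) c j * phi j x)) @ \oo --> 0%E ->
  lam i != 0 -> ip u (phi i) = c i.
Proof.
move=> u2 c0 cvu li0.
have s2 n : L2 (fun x => \sum_(j < n) c j * phi j x).
  by apply: (@inL2_sum _ _ _ mu n (fun j x => c j * phi j x)) => j; exact: inL2Z.
have h := sqL2_cvg_ip u2 (phi2 i) s2 cvu.
apply: (cvg_unique _ h) => //; apply: cvg_near_cst; exists i.+1 => // n /= lt_in.
rewrite (ip_suml n (u_ := fun j x => c j * phi j x))//; last by move=> j; exact: inL2Z.
rewrite (bigD1 (Ordinal lt_in))//= ipZl// ortho// eqxx mulr1 big1 ?addr0// => j ji.
rewrite ipZl//; have [lj0|lj0] := eqVneq (lam j) 0; first by rewrite c0// mul0r.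
rewrite ortho//; have [e|] := eqVneq (j : nat) i; last by rewrite mulr0.
by move: ji; rewrite -val_eqE /= e eqxx.
Qed.

Lemma LK_coef u i : L2 u -> lam i != 0 -> ip (L u) (phi i) = lam i * ip u (phi i).
Proof.
move=> u2 li0; apply: (spectral_coef (c := fun j => lam j * ip u (phi j))) => //.
- exact: LKL2.
- by move=> j ->; rewrite mul0r.
- by case: spec => _ _ _; apply.
Qed.

Lemma contraction_coef u i k : L2 u -> lam i != 0 ->
  ip (iter k P u) (phi i) = (1 - a * lam i) ^+ k * ip u (phi i).
Proof.
move=> u2 li0; elim: k => [|k ih]; first by rewrite expr0 mul1r.
have v2 := iter_contraction_inL2 a mK Ksym Kpsd Kk k u2.
rewrite iterS contractionE ipDl//; last exact: LKL2.
by rewrite LK_coef// ih exprS; ring.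
Qed.

Lemma eigenvalue_le i : lam i != 0 -> lam i <= k2.
Proof.
move=> li0; have := LK_form_le mK Ksym Kpsd Kk (phi2 i).
by rewrite ipC LK_coef// ortho// eqxx !mulr1.
Qed.

(** From |g - s|^2 >= 0, where [s] is the partial expansion of g with the padding coefficients set
    to 0. *)
Lemma Bessel n g : L2 g -> \sum_(i < n | lam i != 0) ip g (phi i) ^+ 2 <= ip g g.
Proof.
move=> g2.
pose c i := if lam i == 0 then 0 else ip g (phi i).
pose s x := \sum_(i < n) c i * phi i x.
have s2 : L2 s.
  by apply: (@inL2_sum _ _ _ mu n (fun j x => c j * phi j x)) => j; exact: inL2Z.
have cE : \sum_(i < n | lam i != 0) ip g (phi i) ^+ 2 = \sum_(i < n) c i ^+ 2.
  rewrite big_mkcond; apply: eq_bigr => i _; rewrite /c.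
  by case: eqP => //= _; rewrite expr0n.
have sg : ip s g = \sum_(i < n) c i ^+ 2.
  rewrite (ip_suml n (u_ := fun j x => c j * phi j x))//; last by move=> j; exact: inL2Z.
  apply: eq_bigr => i _; rewrite ipZl// ipC /c; case: eqP => _; first by rewrite mul0r expr0n.
  by rewrite expr2.
have ss : ip s s = \sum_(i < n) c i ^+ 2.
  rewrite (ip_suml n (u_ := fun j x => c j * phi j x))//; last by move=> j; exact: inL2Z.
  apply: eq_bigr => i _; rewrite ipZl// ipC.
  rewrite (ip_suml n (u_ := fun j x => c j * phi j x))//; last by move=> j; exact: inL2Z.
  have [li0|li0] := eqVneq (lam i) 0; first by rewrite /c li0 eqxx mul0r expr0n.
  rewrite (bigD1 i)//= ipZl// ortho// eqxx mulr1 big1 ?addr0 ?expr2// => j ji.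
  rewrite ipZl//; have [lj0|lj0] := eqVneq (lam j) 0; first by rewrite /c lj0 eqxx mul0r.
  rewrite ortho//; have [e|] := eqVneq (j : nat) i; last by rewrite mulr0.
  by move: ji; rewrite -val_eqE /= e eqxx.
have := ip_ge0 mu (fun x => g x + (-1) * s x).
rewrite ipDl//; last exact: inL2D.
by rewrite !ipDr// (ipC mu g s) ss sg cE; lra.
Qed.

Lemma spectral_bias (r : R) (g h : X -> R) (T : nat) : 0 < r -> L2 g -> L2 h ->
  (fun n => sqL2 mu (fun x => h x -
     \sum_(i < n) (lam i `^ r) * ip g (phi i) * phi i x)) @ \oo --> 0%E -> (0 < T)%N ->
  ip (iter T P h) (iter T P h) <= (r / (a * T%:R)) `^ r ^+ 2 * ip g g.
Proof.
move=> r0 g2 h2 cvh T0.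
pose c i := lam i `^ r * ip g (phi i).
have c0 j : lam j = 0 -> c j = 0.
  by move=> l0; rewrite /c l0 powR0 ?mul0r// gt_eqF.
have hE i : lam i != 0 -> ip h (phi i) = c i by apply: spectral_coef.
have v2 := iter_contraction_inL2 a mK Ksym Kpsd Kk (T + T) h2.
have s2 n : L2 (fun x => \sum_(j < n) c j * phi j x).
  by apply: (@inL2_sum _ _ _ mu n (fun j x => c j * phi j x)) => j; exact: inL2Z.
have cv := sqL2_cvg_ip h2 v2 s2 cvh.
(* With all 2T factors on the right, only the left argument has to be expanded in a series; the
   other enters through its exact coefficients. *)
have -> : ip (iter T P h) (iter T P h) = ip h (iter (T + T) P h).
  rewrite iterD (iter_contraction_selfadjoint a mK Ksym Kpsd Kk)//.
  exact: iter_contraction_inL2.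
have cvl : cvgn (fun n => ip (fun x => \sum_(j < n) c j * phi j x) (iter (T + T) P h)).
  by apply/cvg_ex; exists (ip h (iter (T + T) P h)).
rewrite -(cvg_lim _ cv)//; apply: limr_le => //; near=> n.
rewrite (ip_suml n (u_ := fun j x => c j * phi j x))//; last by move=> j; exact: inL2Z.
apply: (@le_trans _ _ (\sum_(i < n | lam i != 0)
    (r / (a * T%:R)) `^ r ^+ 2 * ip g (phi i) ^+ 2)).
  rewrite [leRHS]big_mkcond; apply: ler_sum => i _; rewrite ipZl//.
  have [li0|li0] := eqVneq (lam i) 0; first by rewrite c0// mul0r.
  rewrite ipC contraction_coef// hE// /c.
  set p := lam i `^ r; set q := 1 - a * lam i; set y := ip g (phi i).
  have -> : p * y * (q ^+ (T + T) * (p * y)) = (p * q ^+ T) ^+ 2 * y ^+ 2.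
    by rewrite exprD; ring.
  rewrite ler_wpM2r ?sqr_ge0//.
  have lp : 0 < lam i by rewrite lt_def li0 lam0.
  have al : a * lam i <= 1.
    by apply: le_trans ak2; rewrite ler_wpM2l ?(ltW a_gt0)// eigenvalue_le.
  rewrite ler_pXn2r ?nnegrE ?powR_ge0//; first exact: powR_mul_contraction_le.
  by rewrite mulr_ge0 ?powR_ge0// exprn_ge0// subr_ge0.
by rewrite -mulr_sumr ler_wpM2l ?sqr_ge0//; exact: Bessel.
Unshelve. all: by end_near. Qed.

End SpectralBias.

(** * Disintegration and the regression function *)

Section MarginalProbability.
Context {R : realType} {d : measure_display} {X : measurableType d}.
Variable rho : probability (X * R)%type R.

Lemma marginal_setT : marginal rho setT = 1%E.
Proof. by rewrite /marginal /pushforward preimage_setT probability_setT. Qed.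

HB.instance Definition _ := Measure_isProbability.Build _ _ _ (marginal rho) marginal_setT.

Definition marginal_probability : probability X R := marginal rho.

End MarginalProbability.

Section Disintegration.
Context {R : realType} {d : measure_display} {X : measurableType d}.
Variables (rho : probability (X * R)%type R) (cond : X -> probability R R).
Local Notation mu := (marginal_probability rho).

Lemma ge0_integral_marginal (f : X -> \bar R) : measurable_fun setT f ->
  (forall x, (0 <= f x)%E) -> (\int[rho]_z f z.1 = \int[mu]_x f x)%E.
Proof.
move=> mf f0.
have := @ge0_integral_pushforward _ _ _ _ _ _ measurable_fst rho setT f measurableT mf.
by rewrite preimage_setT => -> // x _; exact: f0.
Qed.

Lemma integral_marginal (f : X -> \bar R) : measurable_fun setT f ->
  (\int[rho]_z f z.1 = \int[mu]_x f x)%E.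
Proof.
move=> mf; rewrite integralE [RHS]integralE; congr (_ - _)%E.
  rewrite -(ge0_integral_marginal (measurable_funepos mf)) => [|x]; last exact: funepos_ge0.
  by apply: eq_integral => z _; rewrite !funeposE.
rewrite -(ge0_integral_marginal (measurable_funeneg mf)) => [|x]; last exact: funeneg_ge0.
by apply: eq_integral => z _; rewrite !funenegE.
Qed.

Lemma Rintegral_marginal (f : X -> R) : measurable_fun setT f ->
  \int[rho]_z f z.1 = \int[mu]_x f x.
Proof.
move=> mf; rewrite /Rintegral -(@integral_marginal (EFin \o f))//; exact/measurable_EFinP.
Qed.

Lemma inL2_fst (f : X -> R) : inL2 mu f -> inL2 rho (fun z => f z.1).
Proof.
case=> mf f2; split; first exact: measurableT_comp.
rewrite /sqL2 (@ge0_integral_marginal (fun x => ((f x) ^+ 2)%:E))//.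
  by apply/measurable_EFinP; exact: measurable_funX.
by move=> x; rewrite lee_fin sqr_ge0.
Qed.

Hypothesis mcond : forall B, measurable B -> measurable_fun [set: X] (fun x : X => cond x B).
Hypothesis rhoE : forall A B, measurable A -> measurable B ->
  rho (A `*` B) = (\int[marginal rho]_(x in A) cond x B)%E.

(** The product of the Dirac mass at x and [cond x]. As a Giry kernel it gives measurability in x of
    integrals against [cond x], and [rho] as a bind. *)
Let joint x : giry (X * R)%type R :=
  giry_prod (giry_ret x : giry X R, cond x : giry R R).

Let measurable_joint : measurable_fun setT joint.
Proof.
apply: (measurableT_comp measurable_giry_prod) => /=.
apply: measurable_fun_pair; first exact: measurable_giry_ret.
exact: (@measurable_giry_codensity _ _ _ _ _ setT (fun x => cond x : giry R R)).
Qed.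

Let integral_joint x (h : X * R -> \bar R) : measurable_fun setT h ->
  (forall z, (0 <= h z)%E) -> (\int[joint x]_z h z = \int[cond x]_y h (x, y))%E.
Proof.
move=> mh h0.
have := @giry_int_prod1 _ _ _ _ _ (giry_ret x) (cond x : giry R R) h mh h0.
rewrite /giry_int => ->.
have := @giry_int_ret _ X R x (fun x' => \int[cond x]_y h (x', y))%E.
rewrite /giry_int => -> //.
exact: (measurable_fun_fubini_tonelli_F (m2 := cond x) h mh h0).
Qed.

Lemma measurable_integral_cond (h : X * R -> \bar R) : measurable_fun setT h ->
  (forall z, (0 <= h z)%E) -> measurable_fun setT (fun x => \int[cond x]_y h (x, y))%E.
Proof.
move=> mh h0; under eq_fun do rewrite -integral_joint//.
exact: (measurableT_comp (measurable_giry_int mh h0) measurable_joint).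
Qed.

(** Binding the marginal to [joint] gives a measure that agrees with [rho] on rectangles by [rhoE];
    these are stable under intersection and generate the product sigma-algebra. *)
Lemma ge0_disintegration (h : X * R -> \bar R) : measurable_fun setT h ->
  (forall z, (0 <= h z)%E) ->
  (\int[rho]_z h z = \int[mu]_x \int[cond x]_y h (x, y))%E.
Proof.
move=> mh h0.
pose bind := giry_bind (mu : giry X R) measurable_joint.
have bindE A B : measurable A -> measurable B -> bind (A `*` B) = rho (A `*` B).
  move=> mA mB; rewrite rhoE//.
  have mAB : measurable (A `*` B) by exact: measurableX.
  have := @giry_int_bind _ _ _ _ _ (mu : giry X R) _ measurable_joint
    (fun z => (\1_(A `*` B) z)%:E).
  rewrite /giry_int integral_indic// setIT => ->; last 2 first.
    exact/measurable_EFinP/measurable_indic.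
    by move=> z; rewrite lee_fin.
  rewrite [RHS]integral_mkcond; apply: eq_integral => x _.
  rewrite integral_indic// setIT /joint /giry_prod /=.
  rewrite product_measure1E//= /patch diracE.
  by case: ifPn => _; rewrite ?mul1e ?mul0e.
have E S : measurable S -> bind S = rho S.
  move=> mS.
  pose C : set (set (X * R)) :=
    [set C | exists2 A, measurable A & exists2 B, measurable B & A `*` B = C].
  apply: (measure_unique C (fun=> setT)) => //.
  - by rewrite measurable_prod_measurableType.
  - move=> _ _ [A1 mA1 [A2 mA2 <-]] [B1 mB1 [B2 mB2 <-]].
    exists (A1 `&` B1); first exact: measurableI.
    exists (A2 `&` B2); first exact: measurableI.
    by rewrite setXI.
  - by move=> n; exists setT => //; exists setT => //; rewrite setXTT.
  - by apply/seteqP; split => // x _; exists 0%N.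
  - by move=> _ [A mA [B mB <-]]; exact: bindE.
  - by move=> n; apply: (@le_lt_trans _ _ 1%E); [exact: sprobability_setT|exact: ltry].
rewrite (eq_measure_integral bind) => [|S mS _]; last by rewrite /= -E.
have := @giry_int_bind _ _ _ _ _ (mu : giry X R) _ measurable_joint h mh h0.
rewrite /giry_int => ->; apply: eq_integral => x _.
exact: integral_joint.
Qed.

Lemma Rintegral_disintegration (F : X * R -> R) (B : R) : measurable_fun setT F ->
  (forall z, `|F z| <= B) ->
  \int[rho]_z F z = \int[mu]_x \int[cond x]_y F (x, y).
Proof.
move=> mF FB.
have iF : rho.-integrable setT (EFin \o F).
  apply: (integrable_le (g := fun=> B)) => //; exact: integrable_cst.
have ic x : (cond x).-integrable setT (EFin \o (fun y => F (x, y))).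
  apply: (integrable_le (g := fun=> B)) => //; last exact: integrable_cst.
  exact: measurableT_comp.
(* The shift by [B] makes the integrand nonnegative; all measures have mass 1, so the constant
   cancels at the end. *)
have h0 z : 0 <= F z + B by have := FB z; rewrite ler_norml; lra.
have E : (\int[rho]_z (F z + B)%:E =
    \int[mu]_x (\int[cond x]_y F (x, y) + B)%R%:E)%E.
  rewrite (@ge0_disintegration (fun z => (F z + B)%:E))//; last first.
    by apply/measurable_EFinP; exact: measurable_funD.
  apply: eq_integral => x _.
  have icx := ic x.
  rewrite -[in RHS](Rintegral_cst1 (cond x) B) -RintegralD//; last exact: integrable_cst.
  rewrite fineK//; have := integrable_fin_num measurableT
    (integrable_add (ic x) (integrable_cst (cond x) B)).
  by [].
have im : mu.-integrable setT (EFin \o (fun x => \int[cond x]_y F (x, y))).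
  apply: (integrable_le (g := fun=> B)); last exact: integrable_cst.
    have E2 : (fun x => \int[cond x]_y F (x, y)) =
        fun x => \int[cond x]_y (F (x, y) + B) + (- B).
      apply/funext => x; have icx := ic x; rewrite RintegralD//; last exact: integrable_cst.
      by rewrite Rintegral_cst1 addrK.
    rewrite E2; apply: measurable_funD => //.
    apply: (@measurableT_comp _ _ _ _ _ _ fine) => //.
    apply: (@measurable_integral_cond (fun z => (F z + B)%:E)) => //.
    by apply/measurable_EFinP; exact: measurable_funD.
  move=> x; apply: le_trans (le_normr_Rintegral measurableT (ic x)) _.
  rewrite -[leRHS](Rintegral_cst1 (cond x)); apply: Rintegral_mono => //.
    apply: (integrable_le (g := fun=> B)) => //; last exact: integrable_cst.
      by apply: measurableT_comp => //; exact: measurableT_comp.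
    by move=> y; rewrite normr_id.
  exact: integrable_cst.
have := congr1 fine E; rewrite -!/(Rintegral _ _ _).
rewrite RintegralD//; last exact: integrable_cst.
rewrite RintegralD//; last exact: integrable_cst.
by rewrite !Rintegral_cst1 => /addIr.
Qed.

Lemma measurable_regression : measurable_fun setT (regression cond).
Proof.
apply: (@measurableT_comp _ _ _ _ _ _ fine) => //.
have m2 : measurable_fun setT (fun z : X * R => (z.2)%:E) by exact/measurable_EFinP.
have -> : (fun x => \int[cond x]_y y%:E)%E =
    (fun x => (\int[cond x]_y ((fun z : X * R => (z.2)%:E)^\+ (x, y)) -
               \int[cond x]_y ((fun z : X * R => (z.2)%:E)^\- (x, y)))%E).
  by apply/funext => x; rewrite integralE; congr (_ - _)%E; apply: eq_integral => y _;
    rewrite ?funeposE ?funenegE.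
apply: emeasurable_funB; apply: measurable_integral_cond.
- exact: measurable_funepos.
- by move=> z; exact: funepos_ge0.
- exact: measurable_funeneg.
- by move=> z; exact: funeneg_ge0.
Qed.

Variable M : R.
Hypothesis M_gt0 : 0 < M.
Hypothesis rhoM : {ae rho, forall z : X * R, `|z.2| <= M}.

(** Truncation turns the almost sure bound on outputs into the pointwise bound that
    [Rintegral_disintegration] requires. *)
Let clip (y : R) : R := Num.max (- M) (Num.min y M).

Let clip_le y : `|clip y| <= M.
Proof.
rewrite /clip ler_norml le_max lexx /= ge_max ge_min lexx orbT andbT.
by have := ltW M_gt0; lra.
Qed.

Let clip_id y : `|y| <= M -> clip y = y.
Proof. by rewrite ler_norml /clip => /andP[? ?]; rewrite min_l// max_r. Qed.

Let measurable_clip : measurable_fun setT clip.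
Proof.
by apply: measurable_maxr => //; exact: measurable_minr.
Qed.

Let measurable_large : measurable [set y : R | M < `|y|].
Proof.
have := @measurable_funTS _ _ _ _ setT _ (@normr_measurable R setT) measurableT
  _ (measurable_itv `]M, +oo[).
congr measurable; apply/seteqP; split => y /=; rewrite in_itv /= andbT//.
by case.
Qed.

Let ae_cond : {ae mu, forall x, cond x [set y | M < `|y|] = 0%E}.
Proof.
pose N : set R := [set y | M < `|y|].
have mN : measurable N by exact: measurable_large.
have mcN := mcond mN.
(* By [rhoE] this integral is the mass of the strip over [N], which is null by [rhoM]. *)
have /(ae_eq_integral_abs _ measurableT mcN) : (\int[mu]_x `|cond x N| = 0)%E.
  rewrite (eq_integral (fun x => cond x N)) => [|x _]; last by rewrite gee0_abs.
  rewrite -(rhoE measurableT mN); have [N' [mN' rN' sN']] := rhoM.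
  apply: (subset_measure0 _ _ _ rN') => //; first exact: measurableX.
  apply: subset_trans sN' => z [_ /=]; rewrite /N /= => h.
  by apply/negP; rewrite -ltNge.
by apply: filterS => x /(_ I).
Qed.

Let ae_regression : {ae mu, forall x, regression cond x = \int[cond x]_y clip y}.
Proof.
move: ae_cond; apply: filterS => x cx; rewrite /regression; congr fine.
apply: ae_eq_integral => //; first exact/measurable_EFinP.
exists [set y | M < `|y|]; split => //.
move=> y /= h; rewrite ltNge; apply/negP => yM; apply: h => _.
by rewrite clip_id.
Qed.

(** The characteristic property of a conditional expectation. The output is truncated on a set of
    full measure, the disintegration is applied, and the truncation is undone inside [cond x] for
    almost every x. *)
Lemma regression_ip (phi : X -> R) (B : R) : measurable_fun setT phi ->
  (forall x, `|phi x| <= B) ->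
  \int[rho]_z (z.2 * phi z.1) = \int[mu]_x (regression cond x * phi x).
Proof.
move=> mphi phiB.
have mclip2 : measurable_fun setT (fun z : X * R => clip z.2).
  exact: (measurableT_comp measurable_clip measurable_snd).
have mphi1 : measurable_fun setT (fun z : X * R => phi z.1).
  exact: (measurableT_comp mphi measurable_fst).
transitivity (\int[rho]_z (clip z.2 * phi z.1)).
  congr fine; apply: ae_eq_integral => //.
  - by apply/measurable_EFinP; apply: measurable_funM.
  - by apply/measurable_EFinP; apply: measurable_funM.
  - by move: rhoM; apply: filterS => z zM _; rewrite clip_id.
rewrite (@Rintegral_disintegration (fun z => clip z.2 * phi z.1) (M * B)); last 2 first.
- exact: measurable_funM.
- by move=> z; rewrite normrM ler_pM.
have ic x : (cond x).-integrable setT (EFin \o clip).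
  by apply: (integrable_le (g := fun=> M)) => //; exact: integrable_cst.
have mI : measurable_fun setT (fun x => \int[cond x]_y clip y * phi x).
  apply: measurable_funM => //.
  have E2 : (fun x => \int[cond x]_y clip y) =
      fun x => \int[cond x]_y (clip y + M) + (- M).
    apply/funext => x; have icx := ic x; rewrite RintegralD//; last exact: integrable_cst.
    by rewrite Rintegral_cst1 addrK.
  rewrite E2; apply: measurable_funD => //.
  apply: (@measurableT_comp _ _ _ _ _ _ fine) => //.
  apply: (@measurable_integral_cond (fun z => (clip z.2 + M)%:E)) => //.
    by apply/measurable_EFinP; exact: measurable_funD.
  by move=> z; rewrite lee_fin; have := clip_le z.2; rewrite ler_norml; lra.
transitivity (\int[mu]_x (\int[cond x]_y clip y * phi x)).
  apply: eq_Rintegral => x _.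
  rewrite mulrC -(RintegralZl (phi x) measurableT (ic x)).
  by apply: eq_Rintegral => y _; rewrite mulrC.
congr fine; apply: ae_eq_integral => //; first exact/measurable_EFinP.
  apply/measurable_EFinP; apply: measurable_funM => //; exact: measurable_regression.
by move: ae_regression; apply: filterS => x -> _.
Qed.

Lemma output_sqL2_le : (sqL2 rho snd <= (M ^+ 2)%:E)%E.
Proof.
have m2 : measurable_fun setT (fun z : X * R => (z.2 ^+ 2)%:E).
  by apply/measurable_EFinP; apply: measurable_funX; exact: measurable_snd.
rewrite /sqL2 (eq_integral (fun z : X * R => `|(z.2 ^+ 2)%:E|%E)); last first.
  by move=> z _; rewrite gee0_abs// lee_fin sqr_ge0.
apply: le_trans (integral_le_bound (M ^+ 2)%:E measurableT m2 _ _) _.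
- by rewrite lee_fin sqr_ge0.
- move: rhoM; apply: filterS => z zM _; rewrite lee_fin normrX.
  by rewrite ler_pXn2r ?nnegrE// ltW.
- by rewrite [X in (_ * X)%E]probability_setT mule1.
Qed.

Lemma output_inL2 : inL2 rho snd.
Proof.
split; first exact: measurable_snd.
by apply: le_lt_trans output_sqL2_le _; exact: ltry.
Qed.

Lemma output_ip_le : ipL2 rho snd snd <= M ^+ 2.
Proof. by rewrite -lee_fin -sqL2_ip ?output_sqL2_le//; exact: output_inL2. Qed.

End Disintegration.

(** * The window derivative *)

Section WindowDerivative.
Context {R : realType}.
Variables (W : R -> R) (W0 p cp : R).
Hypothesis W0_gt0 : 0 < W0.
Hypothesis dW : forall s, 0 < s -> derivable W s 1 /\ 0 < derive1 W s.
Hypothesis bW : has_ubound [set `|derive1 W s| | s in `]0, +oo[%classic].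
Hypothesis p_gt0 : 0 < p.
Hypothesis cp_gt0 : 0 < cp.
Hypothesis Wcp : forall s, 0 < s -> `|derive1 W s - W0| <= cp * s `^ p.

Lemma derive1_le_CW s : 0 < s -> `|derive1 W s| <= CW W.
Proof.
by move=> s0; apply: ub_le_sup => //; exists s => //=; rewrite in_itv /= s0.
Qed.

(** [CW] is a supremum over s > 0 and does not see the value at 0; (W2) makes the derivative at
    small s arbitrarily close to [W0]. *)
Lemma W0_le_CW : W0 <= CW W.
Proof.
apply/ler_addgt0Pr => e e0.
(* The point at which the bound of (W2) equals [e]. *)
have s0 : 0 < (e / cp) `^ p^-1 by rewrite powR_gt0// divr_gt0.
have := Wcp s0; rewrite -powRrM mulVf ?gt_eqF// powRr1; last first.
  by rewrite divr_ge0// ltW.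
rewrite [cp * _]mulrC divfK ?gt_eqF// => h1; have := derive1_le_CW s0.
rewrite !ler_norml in h1 * => /andP[_ h2]; case/andP : h1; lra.
Qed.

Lemma Wd_ge0 s : 0 <= s -> 0 <= Wd W W0 s.
Proof.
rewrite /Wd; case: eqP => [_ _|/eqP s0 s1]; first exact: ltW.
by apply: ltW; apply: (dW _).2; rewrite lt_def s0.
Qed.

Lemma Wd_le_CW s : 0 <= s -> Wd W W0 s <= CW W.
Proof.
rewrite /Wd; case: eqP => [_ _|/eqP s0 s1]; first exact: W0_le_CW.
by apply: le_trans (ler_norm _) _; apply: derive1_le_CW; rewrite lt_def s0.
Qed.

Lemma Wd_sub_le s : 0 <= s -> `|Wd W W0 s - W0| <= cp * s `^ p.
Proof.
rewrite /Wd; case: eqP => [_ _|/eqP s0 s1].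
  by rewrite subrr normr0 mulr_ge0 ?powR_ge0// ltW.
by apply: Wcp; rewrite lt_def s0.
Qed.

(** For positive arguments the derivative is the pointwise limit of difference quotients with steps
    1 / (n + 1), each of them measurable; the value at 0 is put in by hand. *)
Lemma measurable_Wd_comp d (T : measurableType d) (q : T -> R) :
  measurable_fun setT q -> (forall t, 0 <= q t) ->
  measurable_fun setT (fun t => Wd W W0 (q t)).
Proof.
move=> mq q0.
(* [W] is known to be continuous only on the open half-line; [V] is measurable on the whole line. *)
pose V s := if s <= 0 then 0 else W s.
have mle : measurable_fun setT (fun s : R => s <= 0) by exact: measurable_fun_ler.
have mV : measurable_fun setT V.
  apply: measurable_fun_if => //.
  rewrite (_ : _ `&` _ = `]0, +oo[%classic).
    apply: open_continuous_measurable_fun => // s; rewrite inE /= in_itv /= andbT => s0.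
    by apply: differentiable_continuous; apply/derivable1_diffP; exact: (dW s0).1.
  by apply/seteqP; split => y /=; rewrite in_itv /= andbT leNgt;
    [move=> [_ /negbFE]|move=> ->].
pose D (n : nat) s := if s <= 0 then W0 else n.+1%:R * (V (n.+1%:R^-1 + s) - V s).
have mD n : measurable_fun setT (D n).
  apply: measurable_fun_ifT => //.
  apply: measurable_funM => //; apply: measurable_funB => //.
  by apply: measurableT_comp => //; exact: measurable_funD.
apply: (@measurable_fun_cvg _ _ _ setT (fun n t => D n (q t))).
  by move=> n; apply: measurableT_comp.
move=> t _; have := q0 t; rewrite le_eqVlt => /predU1P[q00|qp].
  by rewrite /Wd /D -q00 eqxx lexx; exact: cvg_cst.
rewrite /Wd gt_eqF// /D leNgt qp /=.
have [dq _] := dW qp.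
have hq := cvg_dnbhs_at_right dq.
have := (cvg_at_rightP _ _ _).1 hq (@harmonic R).
have hh : (forall n, 0 < @harmonic R n) /\ @harmonic R n @[n --> \oo] --> (0 : R).
  by split; [move=> n; rewrite /harmonic /= invr_gt0|exact: cvg_harmonic].
move=> /(_ hh); rewrite -[lim _]/('D_1 W (q t)) -derive1E.
apply: cvg_trans; apply: near_eq_cvg; near=> n.
rewrite /harmonic /= /V invrK [_%:A]mulr1 !leNgt qp /=.
by rewrite addr_gt0//= invr_gt0.
Unshelve. all: by end_near. Qed.

End WindowDerivative.

(** * The Markov operator of the algorithm *)

Section OnlineOperator.
Context {R : realType} {d : measure_display} {X : measurableType d}.
Variables (rho : probability (X * R)%type R) (step : (X -> R) -> X * R -> X -> R).

Definition jointly_measurable d' (O : measurableType d') (F : O -> X -> R) :=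
  measurable_fun setT (fun wx : O * X => F wx.1 wx.2).

Hypothesis measurable_step : forall d' (O : measurableType d') (F : O -> X -> R),
  jointly_measurable F -> jointly_measurable (fun wz : O * (X * R) => step (F wz.1) wz.2).

(** The function space carries no sigma-algebra; measurability is tested along all jointly
    measurable families, a class that the algorithm preserves. *)
Definition measurable_functional (Phi : (X -> R) -> \bar R) :=
  forall d' (O : measurableType d') (F : O -> X -> R), jointly_measurable F ->
  measurable_fun setT (fun w => Phi (F w)).

Definition markov (Phi : (X -> R) -> \bar R) (f : X -> R) : \bar R :=
  (\int[rho]_z Phi (step f z))%E.

(** The outermost integral of [expect] is over the first sample, which [foldl] also consumes first,
    so both sides peel off the same operator. *)
Lemma expect_markov n (Phi : (X -> R) -> \bar R) f :
  expect rho n (fun zs => Phi (foldl step f zs)) = iter n markov Phi f.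
Proof.
elim: n f => // n ih f; rewrite iterS /markov /=.
by apply: eq_integral => z _; rewrite ih.
Qed.

Lemma jointly_measurable_step f : measurable_fun setT f -> jointly_measurable (step f).
Proof.
move=> mf.
have h : jointly_measurable (fun wz : unit * (X * R) => step f wz.2).
  apply: (measurable_step (F := fun _ => f)); exact: measurableT_comp.
apply: (measurable_fun2_comp h (f := fun zx : (X * R) * X => (tt, zx.1)) (g := snd)) => //.
by apply: measurable_fun_pair.
Qed.

Lemma measurable_stepT f z : measurable_fun setT f -> measurable_fun setT (step f z).
Proof.
move=> mf; exact: (measurable_fun2_comp (jointly_measurable_step mf)
  (f := fun=> z) (g := id)).
Qed.

Lemma markov_ge0 (Phi : (X -> R) -> \bar R) (Phi0 : forall f, (0 <= Phi f)%E) n f :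
  (0 <= iter n markov Phi f)%E.
Proof. by elim: n f => // n ih f; apply: integral_ge0 => z _; exact: ih. Qed.

Lemma measurable_markov (Phi : (X -> R) -> \bar R) : (forall f, (0 <= Phi f)%E) ->
  measurable_functional Phi -> measurable_functional (markov Phi).
Proof.
move=> P0 mP d' O F mF; rewrite /markov.
apply: (@measurable_fun_fubini_tonelli_F _ _ _ _ _ rho
  (fun wz : O * (X * R) => Phi (step (F wz.1) wz.2))) => //.
exact: mP (measurable_step mF).
Qed.

End OnlineOperator.

Section OnlineOperatorTheory.
Context {R : realType} {d : measure_display} {X : measurableType d}.
Variables (rho : probability (X * R)%type R) (step : (X -> R) -> X * R -> X -> R).
Hypothesis measurable_step : forall d' (O : measurableType d') (F : O -> X -> R),
  jointly_measurable F -> jointly_measurable (fun wz : O * (X * R) => step (F wz.1) wz.2).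
Local Notation markov := (markov rho step).

Lemma measurable_iter_markov n (Phi : (X -> R) -> \bar R) : (forall f, (0 <= Phi f)%E) ->
  measurable_functional Phi -> measurable_functional (iter n markov Phi).
Proof.
move=> P0 mP; elim: n => //= n ih; apply: measurable_markov => // f; exact: markov_ge0.
Qed.

Lemma iter_markovS n Phi f :
  iter n.+1 markov Phi f = (\int[rho]_z iter n markov Phi (step f z))%E.
Proof. by []. Qed.

Let measurable_along Phi f : measurable_functional Phi -> measurable_fun setT f ->
  measurable_fun setT (fun z => Phi (step f z)).
Proof. by move=> mP mf; apply: mP; exact: jointly_measurable_step. Qed.

(** Nonnegativity makes additivity hold even with infinite values; [c] passes through unchanged
    because [rho] has mass 1. *)
Lemma markov_lin n (Phi Psi : (X -> R) -> \bar R) (a b c : R) :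
  (forall f, (0 <= Phi f)%E) -> (forall f, (0 <= Psi f)%E) ->
  measurable_functional Phi -> measurable_functional Psi -> 0 <= a -> 0 <= b -> 0 <= c ->
  forall f, measurable_fun setT f ->
  iter n markov (fun f => a%:E * Phi f + b%:E * Psi f + c%:E)%E f =
  (a%:E * iter n markov Phi f + b%:E * iter n markov Psi f + c%:E)%E.
Proof.
move=> P0 S0 mP mS a0 b0 c0; elim: n => // n ih f mf.
rewrite !iter_markovS.
have mP' := measurable_along (measurable_iter_markov n P0 mP) mf.
have mS' := measurable_along (measurable_iter_markov n S0 mS) mf.
have P0' z := markov_ge0 rho step P0 n (step f z).
have S0' z := markov_ge0 rho step S0 n (step f z).
rewrite (eq_integral (fun z => (a%:E * iter n markov Phi (step f z) +
    b%:E * iter n markov Psi (step f z)) + c%:E)%E); last first.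
  by move=> z _; rewrite ih//; exact: measurable_stepT.
have aP z : setT z -> (0 <= a%:E * iter n markov Phi (step f z))%E.
  by move=> _; rewrite mule_ge0// lee_fin.
have bS z : setT z -> (0 <= b%:E * iter n markov Psi (step f z))%E.
  by move=> _; rewrite mule_ge0// lee_fin.
have ab z : setT z -> (0 <= a%:E * iter n markov Phi (step f z) +
    b%:E * iter n markov Psi (step f z))%E by move=> zT; rewrite adde_ge0// ?aP ?bS.
have c0' (z : X * R) : setT z -> (0 <= c%:E)%E by rewrite lee_fin.
have maP := measurable_funeM a%:E mP'; have mbS := measurable_funeM b%:E mS'.
have mab := emeasurable_funD maP mbS.
rewrite (ge0_integralD rho measurableT ab mab c0' (measurable_cst _)).
rewrite (ge0_integralD rho measurableT aP maP bS mbS).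
rewrite !ge0_integralZl//= ?lee_fin//.
congr (_ + _)%E; rewrite integral_cst//=.
by rewrite [X in (_ * X)%E]probability_setT mule1.
Qed.

Variable reach : nat -> (X -> R) -> Prop.
Hypothesis reach_measurable : forall n f, reach n f -> measurable_fun setT f.
Hypothesis reach_step : forall n f, reach n f ->
  {ae rho, forall z, reach n.+1 (step f z)}.

(** The functionals are compared only at functions that the algorithm can reach; reachability
    survives each step almost surely, which is enough under the integral. *)
Lemma markov_le n m (Phi Psi : (X -> R) -> \bar R) :
  (forall f, (0 <= Phi f)%E) -> (forall f, (0 <= Psi f)%E) ->
  measurable_functional Phi -> measurable_functional Psi ->
  (forall f, reach (m + n) f -> (Phi f <= Psi f)%E) ->
  forall f, reach m f -> (iter n markov Phi f <= iter n markov Psi f)%E.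
Proof.
move=> P0 S0 mP mS; elim: n m => [|n ih] m le f rf; first by apply: le; rewrite addn0.
have mf := reach_measurable rf.
rewrite !iter_markovS; apply: ae_ge0_le_integral => //.
- by move=> z _; exact: markov_ge0.
- exact: (measurable_along (measurable_iter_markov n P0 mP)).
- by move=> z _; exact: markov_ge0.
- exact: (measurable_along (measurable_iter_markov n S0 mS)).
- move: (reach_step rf); apply: filterS => z rz _; apply: (ih m.+1) => // g.
  by rewrite addSnnS; exact: le.
Qed.

End OnlineOperatorTheory.

(** * One step of the algorithm *)

Section OneStep.
Context {R : realType} {d : measure_display} {X : measurableType d}.
Variables (rho : probability (X * R)%type R) (cond : X -> probability R R) (M : R).
Variables (K : X -> X -> R) (W : R -> R) (W0 p cp k2 eta sigma : R).
Hypothesis M_gt0 : 0 < M.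
Hypothesis rhoM : {ae rho, forall z : X * R, `|z.2| <= M}.
Hypothesis mcond : forall B, measurable B -> measurable_fun [set: X] (fun x : X => cond x B).
Hypothesis rhoE : forall A B, measurable A -> measurable B ->
  rho (A `*` B) = (\int[marginal rho]_(x in A) cond x B)%E.
Hypothesis mK : measurable_fun setT (fun xy : X * X => K xy.1 xy.2).
Hypothesis Ksym : forall x x', K x x' = K x' x.
Hypothesis Kpsd : psd_kernel K.
Hypothesis Kk : forall x, K x x <= k2.
Hypothesis W0_gt0 : 0 < W0.
Hypothesis dW : forall s, 0 < s -> derivable W s 1 /\ 0 < derive1 W s.
Hypothesis bW : has_ubound [set `|derive1 W s| | s in `]0, +oo[%classic].
Hypothesis p_gt0 : 0 < p.
Hypothesis cp_gt0 : 0 < cp.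
Hypothesis Wcp : forall s, 0 < s -> `|derive1 W s - W0| <= cp * s `^ p.
Hypothesis eta_gt0 : 0 < eta.
Hypothesis sigma_gt0 : 0 < sigma.
Hypothesis etaC : eta * CW W * k2 <= 1.

Local Notation mu := (marginal_probability rho).
Local Notation ip := (ipL2 mu).
Local Notation L := (LK mu K).
Local Notation "'L2'" := (inL2 mu).
Local Notation a := (eta * W0).
Local Notation P := (contraction mu K a).
Local Notation step := (online_step W W0 K eta sigma).
Local Notation fr := (regression cond).
Local Notation sectionL2 := (kernel_section_inL2 mu mK Ksym Kpsd Kk).
Local Notation weight f z := (Wd W W0 ((z.2 - f z.1) ^+ 2 / sigma ^+ 2)).

Let a_gt0 : 0 < a. Proof. exact: mulr_gt0. Qed.

Let k2_ge0 : 0 <= k2.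
Proof.
by have [x _] := probability_inhabited mu; exact: le_trans (kdiag_ge0 Ksym Kpsd x) (Kk x).
Qed.

Let ak2 : a * k2 <= 1.
Proof.
apply: le_trans etaC; rewrite ler_wpM2r// ler_wpM2l ?(ltW eta_gt0)//.
exact: (W0_le_CW bW p_gt0 cp_gt0 Wcp).
Qed.

Let xi_ge0 (t : R) : 0 <= t ^+ 2 / sigma ^+ 2.
Proof. by apply: divr_ge0; exact: sqr_ge0. Qed.

Lemma measurable_weight d' (O : measurableType d') (q : O -> R) :
  measurable_fun setT q -> measurable_fun setT (fun t => Wd W W0 (q t ^+ 2 / sigma ^+ 2)).
Proof.
move=> mq; apply: measurable_Wd_comp => //.
by apply: measurable_funM => //; exact: measurable_funX.
Qed.

Lemma measurable_online_step d' (O : measurableType d') (F : O -> X -> R) :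
  jointly_measurable F -> jointly_measurable (fun wz : O * (X * R) => step (F wz.1) wz.2).
Proof.
move=> mF; rewrite /jointly_measurable /online_step /=.
have m1 : measurable_fun setT (fun wx : (O * (X * R)) * X => F wx.1.1 wx.2).
  by apply: (measurable_fun2_comp mF) => //; exact: measurableT_comp.
have mz1 : measurable_fun setT (fun wx : (O * (X * R)) * X => wx.1.2.1).
  apply: (measurableT_comp measurable_fst); exact: (measurableT_comp measurable_snd).
have mz2 : measurable_fun setT (fun wx : (O * (X * R)) * X => wx.1.2.2).
  apply: (measurableT_comp measurable_snd); exact: (measurableT_comp measurable_snd).
have m2 : measurable_fun setT (fun wx : (O * (X * R)) * X => F wx.1.1 wx.1.2.1).
  by apply: (measurable_fun2_comp mF) => //; exact: measurableT_comp.
apply: measurable_funB => //; apply: measurable_funM.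
  apply: measurable_funM; last exact: measurable_funB.
  by apply: measurable_funM => //; apply: measurable_weight; exact: measurable_funB.
exact: (measurable_fun2_comp mK).
Qed.

(* The functions the algorithm can have produced after n steps, with the RKHS norm
   bound that holds for them when eta CW kappa^2 <= 1. *)
Definition reachable n (f : X -> R) := exists s : seq (R * X),
  f = kcomb K s /\ knorm2 K s <= n%:R * (eta * CW W * M ^+ 2).

Lemma reachable0 : reachable 0 (fun=> 0).
Proof.
exists [::]; split; last by rewrite /knorm2 big_nil mul0r.
by apply/funext => x; rewrite /kcomb big_nil.
Qed.

Lemma reachable_sqr_le n f x : reachable n f ->
  f x ^+ 2 <= k2 * (n%:R * (eta * CW W * M ^+ 2)).
Proof.
move=> [s [-> sn]]; apply: le_trans (kcomb_le Ksym Kpsd s x) _.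
by apply: ler_pM => //; [exact: kdiag_ge0|exact: knorm2_ge0].
Qed.

Lemma reachable_measurable n f : reachable n f -> measurable_fun setT f.
Proof.
move=> [s [-> _]]; elim: s => [|[c x] s ih].
  rewrite (_ : kcomb K [::] = fun=> 0)//.
  by apply/funext => x; rewrite /kcomb big_nil.
rewrite (_ : kcomb K ((c, x) :: s) = fun y => c * K x y + kcomb K s y).
  apply: measurable_funD => //; apply: measurable_funM => //.
  exact: measurable_kernel_section.
by apply/funext => y; rewrite kcomb_cons.
Qed.

Lemma reachable_inL2 n f : reachable n f -> L2 f.
Proof.
move=> rf; apply: (@inL2_bounded _ _ _ _ _
  (1 + k2 * (n%:R * (eta * CW W * M ^+ 2)))).
  exact: reachable_measurable rf.
move=> x; have := reachable_sqr_le x rf; rewrite -(real_normK (num_real (f x))).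
by have := normr_ge0 (f x); nra.
Qed.

(** With w the weight, eta w K(x, x) <= 1 bounds the growth of the squared norm by eta w ((f(x) -
    y)^2 - 2 f(x) (f(x) - y)) = eta w (y^2 - f(x)^2), hence by eta C_W M^2. *)
Lemma reachable_step n f : reachable n f -> {ae rho, forall z, reachable n.+1 (step f z)}.
Proof.
move=> [s [fE sn]]; move: rhoM; apply: filterS => -[x y] /= yM.
pose w := Wd W W0 ((y - f x) ^+ 2 / sigma ^+ 2).
have w0 : 0 <= w by apply: Wd_ge0.
have wC : w <= CW W by apply: (Wd_le_CW bW p_gt0 cp_gt0 Wcp).
pose c := - (eta * w * (f x - y)).
exists ((c, x) :: s); split.
  by apply/funext => u; rewrite kcomb_cons -fE /online_step /c /w /=; ring.
rewrite knorm2_cons// -fE -[n.+1]addn1 natrD mulrDl mul1r.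
suff : c ^+ 2 * K x x + 2 * c * f x <= eta * CW W * M ^+ 2 by lra.
have wk : eta * w * K x x <= 1.
  apply: le_trans etaC; rewrite -!mulrA ler_wpM2l ?(ltW eta_gt0)//.
  by apply: ler_pM => //; exact: kdiag_ge0.
have yM2 : y ^+ 2 <= M ^+ 2.
  by rewrite -[leLHS]real_normK ?num_real// ler_pXn2r ?nnegrE// ltW.
apply: (@le_trans _ _ (eta * w * y ^+ 2)); last first.
  by rewrite -!mulrA ler_wpM2l ?(ltW eta_gt0)//; apply: ler_pM => //; exact: sqr_ge0.
have ew : 0 <= eta * w by rewrite mulr_ge0// ltW.
have : eta * w * (f x - y) ^+ 2 * (eta * w * K x x) <= eta * w * (f x - y) ^+ 2 * 1.
  by rewrite ler_wpM2l// mulr_ge0// sqr_ge0.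
have -> : c ^+ 2 * K x x = eta * w * (f x - y) ^+ 2 * (eta * w * K x x).
  by rewrite /c; ring.
have : 0 <= eta * w * f x ^+ 2 by rewrite mulr_ge0 ?sqr_ge0.
by rewrite /c; lra.
Qed.

Hypothesis fr2 : L2 fr.

(** [k] counts the later steps through which the error will still be propagated; the larger it is,
    the more the noise of the current step is smoothed. *)
Definition residual_norm2 k (f : X -> R) : \bar R := sqL2 mu (iter k P (fun u => f u - fr u)).

Lemma residual_norm2_ge0 k f : (0 <= residual_norm2 k f)%E.
Proof. by apply: integral_ge0 => x _; rewrite lee_fin sqr_ge0. Qed.

Lemma measurable_residual_norm2 k : measurable_functional (residual_norm2 k).
Proof.
move=> d' O F mF.
have mk : measurable_fun setT (fun wx : O * X => iter k P (fun u => F wx.1 u - fr u) wx.2).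
  elim: k => [|k ih] /=.
    apply: measurable_funB => //; apply: (measurableT_comp fr2.1); exact: measurable_snd.
  apply: measurable_funB => //; apply: measurable_funM => //.
  exact: (measurable_LK_param mu mK
    (f := fun w => iter k P (fun u => F w u - fr u))).
apply: (@measurable_fun_fubini_tonelli_F _ _ _ _ _ mu
  (fun wx : O * X => ((iter k P (fun u => F wx.1 u - fr u) wx.2) ^+ 2)%:E)).
  by apply/measurable_EFinP; exact: measurable_funX.
by move=> z; rewrite lee_fin sqr_ge0.
Qed.

Variable n : nat.
Variable eps : R.
Variable f : X -> R.
Hypothesis rf : reachable n f.
Hypothesis eps_le : {ae rho, forall z : X * R, `|(W0 - weight f z) * (f z.1 - z.2)| <= eps}.

Let e x := f x - fr x.
Let psi (z : X * R) := f z.1 - z.2.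
Let e2 : L2 e. Proof. by apply: inL2_sub => //; exact: reachable_inL2 rf. Qed.

Variable k : nat.
Variable delta : R.
Hypothesis delta_gt0 : 0 < delta.
Let Q := k2 / (a * k.+1%:R).
Let A := iter k P e.
Let A2 : L2 A. Proof. exact: (iter_contraction_inL2 _ mK Ksym Kpsd Kk). Qed.
Let B x := iter k P (K x).
Let B2 x : L2 (B x).
Proof. apply: (iter_contraction_inL2 _ mK Ksym Kpsd Kk); exact: sectionL2. Qed.

(** This is <P^k e, P^k K_x>, written as a value of [L] so that it is visibly bounded and measurable
    and [regression_ip] applies. *)
Let l x := L (iter k P A) x.

Let lE x : ip A (B x) = l x.
Proof.
rewrite /l LKE// /B -(iter_contraction_selfadjoint a mK Ksym Kpsd Kk)//; exact: sectionL2.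
Qed.

(** Young's inequality |u + v|^2 <= (1 + delta) |u|^2 + (1 + 1/delta) |v|^2 for the update u with
    weight [W0] and the correction v of the weight, each |P^k K_x|^2 replaced by its smoothing bound
    [Q]. *)
Let bound (z : X * R) := (1 + delta) * (ip A A - 2 * a * (psi z * l z.1) + a ^+ 2 * Q * psi z ^+ 2)
  + (1 + delta^-1) * eta ^+ 2 * eps ^+ 2 * Q.

Let ip_comb c x : ip (fun u => A u + c * B x u) (fun u => A u + c * B x u) =
  ip A A + 2 * c * l x + c ^+ 2 * ip (B x) (B x).
Proof.
rewrite ipDl//; last exact: inL2D.
by rewrite !ipDr// (ipC mu (B x) A) lE; ring.
Qed.

Let Q_ge0 : 0 <= Q. Proof. by rewrite divr_ge0// mulr_ge0// ltW. Qed.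

Let bound_ge0 z : 0 <= bound z.
Proof.
have d1 : 0 <= 1 + delta by have := delta_gt0; lra.
have di : 0 < delta^-1 by rewrite invr_gt0.
have d2 : 0 <= 1 + delta^-1 by lra.
apply: addr_ge0; last first.
  apply: mulr_ge0 => //; apply: mulr_ge0; last exact: sqr_ge0.
  by apply: mulr_ge0 => //; exact: sqr_ge0.
apply: mulr_ge0 => //.
have := ip_ge0 mu (fun u => A u + (- a * psi z) * B z.1 u); rewrite ip_comb.
have : (a * psi z) ^+ 2 * ip (B z.1) (B z.1) <= (a * psi z) ^+ 2 * Q.
  by rewrite ler_wpM2l ?sqr_ge0// /B /Q smoothing.
rewrite mulNr sqrrN exprMn; lra.
Qed.

Let step_residual z : residual_norm2 k (step f z) =
  (ip A A + 2 * (- (eta * weight f z * psi z)) * l z.1 +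
   (- (eta * weight f z * psi z)) ^+ 2 * ip (B z.1) (B z.1))%:E.
Proof.
rewrite -ip_comb -sqL2_ip; last exact: inL2D.
rewrite /residual_norm2; congr sqL2.
rewrite -(iter_contractionD a mK Ksym Kpsd Kk k _ e2 (sectionL2 z.1)).
by congr (iter k P _); apply/funext => u; rewrite /online_step /e /psi; ring.
Qed.

Let step_residual_le z : `|(W0 - weight f z) * psi z| <= eps ->
  (residual_norm2 k (step f z) <= (bound z)%:E)%E.
Proof.
move=> epsz; rewrite step_residual lee_fin /bound.
set w := weight f z in epsz *; set q := ip (B z.1) (B z.1).
have q0 : 0 <= q by exact: ip_ge0.
have qQ : q <= Q by rewrite /q /B /Q smoothing.
set E := ip A A; set s := psi z in epsz *; set c := eta * ((W0 - w) * s).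
have cE : - (eta * w * s) = - (a * s) + c by rewrite /c; ring.
have c2 : c ^+ 2 * q <= eta ^+ 2 * eps ^+ 2 * Q.
  rewrite /c exprMn; apply: ler_pM => //; first by rewrite mulr_ge0// sqr_ge0.
  rewrite ler_wpM2l ?sqr_ge0// -[leLHS]real_normK ?num_real//.
  by rewrite ler_pXn2r ?nnegrE// (le_trans _ epsz).
have s2 : a ^+ 2 * s ^+ 2 * q <= a ^+ 2 * s ^+ 2 * Q.
  by rewrite ler_wpM2l// mulr_ge0// sqr_ge0.
have d0 : delta != 0 by rewrite gt_eqF.
have di : 0 < delta^-1 by rewrite invr_gt0.
(* The slack in Young's inequality is delta |u - v / delta|^2 with u = A - a s B and v = c B. *)
have := ip_ge0 mu (fun u => A u + (- (a * s) - c / delta) * B z.1 u).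
rewrite ip_comb -/E -/q => H.
rewrite cE.
apply: (@le_trans _ _ ((1 + delta) * (E - 2 * a * (s * l z.1) + a ^+ 2 * s ^+ 2 * q)
  + (1 + delta^-1) * (c ^+ 2 * q))).
  rewrite -subr_ge0.
  rewrite (_ : _ - _ = delta * (E + 2 * (- (a * s) - c / delta) * l z.1 +
      (- (a * s) - c / delta) ^+ 2 * q)); first by rewrite mulr_ge0// ltW.
  by field.
apply: lerD.
  rewrite ler_wpM2l//; first by have := delta_gt0; lra.
  by move: s2; lra.
have -> : (1 + delta^-1) * eta ^+ 2 * eps ^+ 2 * Q = (1 + delta^-1) * (eta ^+ 2 * eps ^+ 2 * Q).
  by ring.
by rewrite ler_wpM2l//; lra.
Qed.

Let psi2 : inL2 rho psi.
Proof.
apply: inL2_sub; first by apply: inL2_fst; exact: reachable_inL2 rf.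
exact: (output_inL2 M_gt0 rhoM).
Qed.

Let l2 : L2 l. Proof. apply: (LK_inL2 mK Ksym Kpsd Kk); exact: (iter_contraction_inL2 _ mK Ksym Kpsd Kk). Qed.

(** The martingale property enters here: conditionally on x, [psi] averages to [e], and <e, L P^k A>
    = <P^k e, L A> by self-adjointness and commutation. *)
Let integral_psi_l : \int[rho]_z (psi z * l z.1) = ip A (L A).
Proof.
have PA2 : L2 (iter k P A) by exact: (iter_contraction_inL2 _ mK Ksym Kpsd Kk).
have ly2 := inL2_fst l2; have f2 := inL2_fst (reachable_inL2 rf).
have y2 := output_inL2 M_gt0 rhoM.
have -> : \int[rho]_z (psi z * l z.1) =
    \int[rho]_z (f z.1 * l z.1) - \int[rho]_z (z.2 * l z.1).
  rewrite -RintegralB//; [|exact: inL2_mul|exact: inL2_mul].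
  by apply: eq_Rintegral => z _; rewrite /psi; ring.
rewrite (Rintegral_marginal rho (f := fun x => f x * l x)); last first.
  by apply: measurable_funM; [exact: reachable_measurable rf|case: l2].
rewrite (regression_ip mcond rhoE M_gt0 rhoM l2.1 (fun x => LK_bounded mK Ksym Kpsd Kk x PA2)).
rewrite -RintegralB//; [|exact: inL2_mul (reachable_inL2 rf) l2|exact: inL2_mul].
transitivity (ip e l); first by rewrite ipE; apply: eq_Rintegral => x _; rewrite /e; ring.
rewrite /l (LK_iter_contraction a mK Ksym Kpsd Kk)//.
by rewrite -(iter_contraction_selfadjoint a mK Ksym Kpsd Kk)//; exact: (LK_inL2 mK Ksym Kpsd Kk).
Qed.

(** From (f - y)^2 <= 2 e^2 + 4 fr^2 + 4 y^2 and E y^2 <= M^2. *)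
Let V := 4 * ip fr fr + 4 * M ^+ 2.

Let integral_psi2_le : \int[rho]_z (psi z ^+ 2) <= 2 * ip e e + V.
Proof.
have y2 := output_inL2 M_gt0 rhoM.
have ie : rho.-integrable setT (EFin \o (fun z => 2 * e z.1 ^+ 2)).
  by apply: integrable_scale; apply: inL2_integrable; exact: inL2_fst.
have ifr : rho.-integrable setT (EFin \o (fun z => 4 * fr z.1 ^+ 2)).
  by apply: integrable_scale; apply: inL2_integrable; exact: inL2_fst.
have iy : rho.-integrable setT (EFin \o (fun z : X * R => z.2 ^+ 2)).
  exact: inL2_integrable.
have ief : rho.-integrable setT (EFin \o (fun z => 2 * e z.1 ^+ 2 + 4 * fr z.1 ^+ 2)).
  exact: integrable_add.
apply: (@le_trans _ _ (\int[rho]_z (2 * e z.1 ^+ 2 + 4 * fr z.1 ^+ 2 + 4 * z.2 ^+ 2))).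
  apply: Rintegral_mono.
  - exact: inL2_integrable.
  - by apply: integrable_add => //; exact: integrable_scale.
  - move=> z; rewrite /psi /e; have := sqr_ge0 (f z.1 - fr z.1 - (fr z.1 - z.2)).
    by have := sqr_ge0 (fr z.1 + z.2); nra.
rewrite Rintegral_lin// RintegralD//.
rewrite !RintegralZl//; last 2 first.
  by apply: inL2_integrable; exact: inL2_fst.
  by apply: inL2_integrable; exact: inL2_fst.
rewrite (Rintegral_marginal rho (f := fun x => e x ^+ 2)); last exact: measurable_funX e2.1.
rewrite (Rintegral_marginal rho (f := fun x => fr x ^+ 2)); last exact: measurable_funX fr2.1.
have := output_ip_le M_gt0 rhoM; rewrite /V !ipE.
have sq d' (T : measurableType d') (m : probability T R) (u : T -> R) :
  \int[m]_x (u x * u x) = \int[m]_x (u x ^+ 2) by apply: eq_Rintegral => x _; rewrite expr2.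
by rewrite !sq; lra.
Qed.

(** [ip_contraction_ge] absorbs the cross term into one more power of [P]. The noise variance
    depends on the current error, which produces the term with [residual_norm2 0]. *)
Lemma residual_norm2_step :
  (markov rho step (residual_norm2 k) f <=
   (1 + delta)%:E * residual_norm2 k.+1 f +
   (2 * (1 + delta) * a ^+ 2 * Q)%:E * residual_norm2 0 f +
   ((1 + delta) * a ^+ 2 * Q * V + (1 + delta^-1) * eta ^+ 2 * eps ^+ 2 * Q)%:E)%E.
Proof.
have ipsi2 := inL2_integrable psi2.
have ipsil : rho.-integrable setT (EFin \o (fun z => psi z * l z.1)).
  by apply: inL2_mul => //; exact: inL2_fst.
have i1 : rho.-integrable setT
    (EFin \o (fun z => ip A A + (- (2 * a)) * (psi z * l z.1))).
  by apply: integrable_add; [exact: integrable_cst|exact: integrable_scale].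
have i2 : rho.-integrable setT
    (EFin \o (fun z => ip A A + (- (2 * a)) * (psi z * l z.1) + a ^+ 2 * Q * psi z ^+ 2)).
  by apply: integrable_add => //; exact: integrable_scale.
have boundE : bound = fun z => (1 + delta^-1) * eta ^+ 2 * eps ^+ 2 * Q + (1 + delta) *
    (ip A A + (- (2 * a)) * (psi z * l z.1) + a ^+ 2 * Q * psi z ^+ 2).
  by apply/funext => z; rewrite /bound; ring.
have ib : rho.-integrable setT (EFin \o bound).
  by rewrite boundE; apply: integrable_add; [exact: integrable_cst|exact: integrable_scale].
apply: (@le_trans _ _ (\int[rho]_z (bound z)%:E)%E).
  apply: ae_ge0_le_integral => //.
  - by move=> z _; exact: residual_norm2_ge0.
  - apply: (measurable_residual_norm2 k).
    apply: (jointly_measurable_step measurable_online_step).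
    exact: reachable_measurable rf.
  - by move=> z _; rewrite lee_fin.
  - exact: measurable_int ib.
  - by move: eps_le; apply: filterS => z epsz _; exact: step_residual_le.
have ibE : (\int[rho]_z (bound z)%:E)%E = (\int[rho]_z bound z)%:E.
  by rewrite fineK//; have := integrable_fin_num measurableT ib.
have PA2 : L2 (P A) by exact: (contraction_inL2 _ mK Ksym Kpsd Kk).
have -> : residual_norm2 k.+1 f = (ip (P A) (P A))%:E by rewrite -sqL2_ip.
have -> : residual_norm2 0 f = (ip e e)%:E by rewrite -sqL2_ip.
rewrite ibE -!EFinM -!EFinD lee_fin boundE Rintegral_lin//; last exact: integrable_cst.
rewrite Rintegral_lin// Rintegral_lin//; last exact: integrable_cst.
rewrite !Rintegral_cst1 integral_psi_l.
have H1 := ip_contraction_ge a mK Ksym Kpsd Kk A2.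
have H2 : a ^+ 2 * Q * \int[rho]_z (psi z ^+ 2) <= a ^+ 2 * Q * (2 * ip e e + V).
  by rewrite ler_wpM2l// mulr_ge0// sqr_ge0.
have H3 : (1 + delta) * (ip A A + - (2 * a) * ip A (L A) +
    a ^+ 2 * Q * \int[rho]_x psi x ^+ 2) <=
    (1 + delta) * (ip (P A) (P A) + a ^+ 2 * Q * (2 * ip e e + V)).
  rewrite ler_wpM2l//; first by have := delta_gt0; lra.
  by lra.
by lra.
Qed.

End OneStep.

(** * The error recursion *)

Section Recursion.
Context {R : realType}.

Lemma sum_inv_le (T : nat) : (0 < T)%N -> \sum_(0 <= i < T) (i.+1%:R)^-1 <= 1 + ln T%:R :> R.
Proof.
case: T => // T _; elim: T => [|T ih]; first by rewrite big_nat1 invr1 ln1 addr0.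
rewrite big_nat_recr//=.
have T1 : (0 : R) < T.+1%:R by rewrite ltr0n.
have T2 : (0 : R) < T.+2%:R by rewrite ltr0n.
apply: le_trans (lerD ih (lexx _)) _; rewrite -addrA lerD2l.
have -> : ln (T.+1%:R : R) = ln (T.+2%:R : R) + ln (T.+1%:R / T.+2%:R).
  by rewrite -lnM ?posrE ?divr_gt0//; congr ln; field; rewrite gt_eqF.
have : ln (T.+1%:R / T.+2%:R : R) <= - T.+2%:R^-1.
  have -> : T.+1%:R / T.+2%:R = 1 + (- T.+2%:R^-1) :> R.
    have e : T.+2%:R = T.+1%:R + 1 :> R by rewrite natr1.
    move: T1; rewrite e; set x := T.+1%:R => x0.
    by field; rewrite gt_eqF// addr_gt0.
  by apply: le_ln1Dx; rewrite ltrN2 invf_lt1// ltr1n.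
set u := ln _; set v := ln _; set w := _^-1; lra.
Qed.

Lemma sum_inv_sqrt_le (T : nat) :
  \sum_(0 <= i < T) (Num.sqrt i.+1%:R)^-1 <= 2 * Num.sqrt T%:R :> R.
Proof.
elim: T => [|T ih]; first by rewrite big_geq// mulr_ge0// sqrtr_ge0.
rewrite big_nat_recr//=.
have s0 : 0 < Num.sqrt T.+1%:R :> R by rewrite sqrtr_gt0 ltr0n.
have t0 : 0 <= Num.sqrt T%:R :> R by exact: sqrtr_ge0.
have ss : Num.sqrt T.+1%:R ^+ 2 = Num.sqrt T%:R ^+ 2 + 1 :> R.
  by rewrite !sqr_sqrtr// natr1.
move: ih s0 t0 ss; set s := Num.sqrt T.+1%:R; set t := Num.sqrt T%:R => ih s0 t0 ss.
(* This is (s - t)^2 >= 0 rewritten with s^2 = t^2 + 1; the right side telescopes. *)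
have : s^-1 <= 2 * s - 2 * t.
  rewrite -(ler_pM2r s0) mulVf ?gt_eqF//.
  by have := sqr_ge0 (s - t); nra.
lra.
Qed.

(** The recursion moves along an antidiagonal n + k = const down to time 0. The factors 1 + dl are
    collected in one exponential, and the terms [H m 0] off the antidiagonal are bounded by [S]. *)
Lemma recursion_unroll (H : nat -> nat -> \bar R) (T : nat) (b dl be c : nat -> R) (S : R) :
  (forall k, 0 <= b k) -> (forall k, 0 <= dl k) -> (forall k, 0 <= be k) ->
  (forall k, 0 <= c k) -> 0 <= S ->
  (forall k, (H 0%N k <= (b k)%:E)%E) ->
  (forall n k, (n + k < T)%N -> (H n.+1 k <=
     (1 + dl k)%:E * H n k.+1 + (be k)%:E * H n 0%N + (c k)%:E)%E) ->
  forall n k, (n + k <= T)%N -> (forall m, (m < n)%N -> (H m 0%N <= S%:E)%E) ->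
  (H n k <= (expR (\sum_(k <= i < k + n) dl i) *
     (b (k + n)%N + \sum_(k <= i < k + n) (be i * S + c i)))%:E)%E.
Proof.
move=> b0 dl0 be0 c0 S0 H0 HS; elim=> [|n ih] k nk HmS.
  by rewrite addn0 !big_geq// expR0 mul1r addr0.
have nkT : (n + k.+1 <= T)%N by rewrite addnS -addSn.
have {}ih := ih k.+1 nkT (fun m mn => HmS m (ltnW mn)).
rewrite addSnnS in ih.
have kn : (k < k + n.+1)%N by rewrite addnS ltnS leq_addr.
apply: le_trans (HS n k _) _; first by rewrite -addSn.
rewrite [in leRHS](big_ltn kn) [in X in _ * (_ + X)](big_ltn kn).
set D := \sum_(k.+1 <= i < k + n.+1) dl i in ih *.
set Z := \sum_(k.+1 <= i < k + n.+1) _ in ih *.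
set B := b _ in ih *.
have B0 : 0 <= B by exact: b0.
have Z0 : 0 <= Z by rewrite /Z; apply: sumr_ge0 => i _; rewrite addr_ge0// mulr_ge0.
have D0 : 0 <= D by rewrite /D; apply: sumr_ge0.
have H00 := HmS n (ltnSn n).
apply: (@le_trans _ _ ((1 + dl k)%:E * (expR D * (B + Z))%:E + (be k)%:E * S%:E + (c k)%:E)%E).
  apply: leeD => //; apply: leeD; apply: lee_wpmul2l => //; rewrite lee_fin//.
  by rewrite addr_ge0.
rewrite -!EFinM -!EFinD lee_fin.
have e1 : 1 + dl k <= expR (dl k) by exact: expR_ge1Dx.
have e2 : 1 <= expR (dl k + D) by rewrite -expR0 ler_expR addr_ge0.
have u0 : 0 <= be k * S + c k by rewrite addr_ge0// mulr_ge0.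
have h1 : (1 + dl k) * (expR D * (B + Z)) <= expR (dl k + D) * (B + Z).
  by rewrite expRD -mulrA ler_wpM2r// mulr_ge0 ?expR_ge0// addr_ge0.
have h2 : be k * S + c k <= expR (dl k + D) * (be k * S + c k) by rewrite ler_peMl.
lra.
Qed.

(** The unrolled estimate is used twice: with the crude bound [F] on the bias it gives a uniform [S]
    by strong induction; at time T it is applied again with this [S], keeping the sharp bias
    [b T]. *)
Lemma recursion_bound (H : nat -> nat -> \bar R) (T : nat) (b dl be c : nat -> R)
    (La V F Et : R) :
  (forall k, 0 <= b k) -> (forall k, 0 <= dl k) -> (forall k, 0 <= be k) ->
  (forall k, 0 <= c k) -> 0 <= V -> 0 <= Et -> 0 <= F -> 0 <= La ->
  (forall k, (H 0%N k <= (b k)%:E)%E) ->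
  (forall n k, (n + k < T)%N -> (H n.+1 k <=
     (1 + dl k)%:E * H n k.+1 + (be k)%:E * H n 0%N + (c k)%:E)%E) ->
  (forall k, b k <= F) ->
  \sum_(0 <= i < T) dl i <= 2 ->
  \sum_(0 <= i < T) be i <= 4 * La ->
  \sum_(0 <= i < T) c i <= 2 * La * V + Et ->
  8 * expR 2 * La <= 1 ->
  (H T 0%N <= (expR 2 * b T + expR 2 * La * (8 * expR 2 * F + 4 * V) + 2 * expR 2 * Et)%:E)%E.
Proof.
move=> b0 dl0 be0 c0 V0 Et0 F0 La0 H0 HS bF sdl sbe sc La1.
have e0 : 0 < expR 2 :> R by exact: expR_gt0.
(* The induction requires expR 2 * (F + La * (4 S + 2 V) + Et) <= S; as 8 * expR 2 * La <= 1, the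
   left side is at most S / 2 + expR 2 * (F + Et) + V / 4, which is this [S]. *)
pose S := 2 * expR 2 * (F + Et) + V / 2.
have S0 : 0 <= S by rewrite /S addr_ge0 ?divr_ge0// !mulr_ge0 ?addr_ge0// ltW.
have sub (u : nat -> R) n : (forall k, 0 <= u k) -> (n <= T)%N ->
    \sum_(0 <= i < n) u i <= \sum_(0 <= i < T) u i.
  move=> u0 nT; rewrite (@big_cat_nat _ _ _ n 0 T)//= lerDl.
  by apply: sumr_ge0.
have key n : (n <= T)%N -> (forall m, (m < n)%N -> (H m 0%N <= S%:E)%E) ->
    (H n 0%N <= (expR 2 * (b n + La * (4 * S + 2 * V) + Et))%:E)%E.
  move=> nT HmS.
  have := recursion_unroll b0 dl0 be0 c0 S0 H0 HS (n := n) (k := 0).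
  rewrite addn0 add0n => /(_ nT HmS) h; apply: le_trans h _; rewrite lee_fin.
  apply: ler_pM; first exact: expR_ge0.
  - rewrite addr_ge0//; apply: sumr_ge0 => i _; rewrite addr_ge0// mulr_ge0//.
  - by rewrite ler_expR; apply: le_trans sdl; exact: sub.
  - rewrite big_split/= -mulr_suml.
    have h1 := sub be n be0 nT; have h2 := sub c n c0 nT.
    have h3 : (\sum_(0 <= i < n) be i) * S <= 4 * La * S.
      by rewrite ler_wpM2r//; apply: le_trans sbe.
    by lra.
have HmS n : (n <= T)%N -> (H n 0%N <= S%:E)%E.
  elim/ltn_ind: n => n ih nT.
  apply: le_trans (key n nT _) _.
    by move=> m mn; apply: ih => //; apply: leq_trans nT; exact: ltnW.
  rewrite lee_fin.
  have h1 : expR 2 * b n <= expR 2 * F by rewrite ler_wpM2l// ltW.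
  have h2 : 8 * expR 2 * La * (S / 2 + V / 4) <= 1 * (S / 2 + V / 4).
    by rewrite ler_wpM2r// addr_ge0// divr_ge0.
  by rewrite {2}/S; move: h2; rewrite {2}/S; lra.
apply: le_trans (key T (leqnn T) (fun m mT => HmS m (ltnW mT))) _.
rewrite lee_fin.
have h : 8 * expR 2 * La * (expR 2 * Et) <= 1 * (expR 2 * Et).
  by rewrite ler_wpM2r// mulr_ge0// ltW.
rewrite /S; move: h; set x := expR 2; lra.
Qed.

End Recursion.

(** * The recursion applied to the algorithm *)

Section ErrorBound.
Context {R : realType} {d : measure_display} {X : measurableType d}.
Variables (rho : probability (X * R)%type R) (cond : X -> probability R R) (M : R).
Variables (K : X -> X -> R) (W : R -> R) (W0 p cp k2 eta sigma : R).
Hypothesis M_gt0 : 0 < M.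
Hypothesis rhoM : {ae rho, forall z : X * R, `|z.2| <= M}.
Hypothesis mcond : forall B, measurable B -> measurable_fun [set: X] (fun x : X => cond x B).
Hypothesis rhoE : forall A B, measurable A -> measurable B ->
  rho (A `*` B) = (\int[marginal rho]_(x in A) cond x B)%E.
Hypothesis mK : measurable_fun setT (fun xy : X * X => K xy.1 xy.2).
Hypothesis Ksym : forall x x', K x x' = K x' x.
Hypothesis Kpsd : psd_kernel K.
Hypothesis Kk : forall x, K x x <= k2.
Hypothesis W0_gt0 : 0 < W0.
Hypothesis dW : forall s, 0 < s -> derivable W s 1 /\ 0 < derive1 W s.
Hypothesis bW : has_ubound [set `|derive1 W s| | s in `]0, +oo[%classic].
Hypothesis p_gt0 : 0 < p.
Hypothesis cp_gt0 : 0 < cp.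
Hypothesis Wcp : forall s, 0 < s -> `|derive1 W s - W0| <= cp * s `^ p.
Hypothesis eta_gt0 : 0 < eta.
Hypothesis sigma_gt0 : 0 < sigma.
Hypothesis etaC : eta * CW W * k2 <= 1.

Local Notation mu := (marginal_probability rho).
Local Notation ip := (ipL2 mu).
Local Notation L := (LK mu K).
Local Notation "'L2'" := (inL2 mu).
Local Notation a := (eta * W0).
Local Notation P := (contraction mu K a).
Local Notation step := (online_step W W0 K eta sigma).
Local Notation fr := (regression cond).
Local Notation sectionL2 := (kernel_section_inL2 mu mK Ksym Kpsd Kk).
Local Notation weight f z := (Wd W W0 ((z.2 - f z.1) ^+ 2 / sigma ^+ 2)).

Let a_gt0 : 0 < a. Proof. exact: mulr_gt0. Qed.

Let k2_ge0 : 0 <= k2.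
Proof.
by have [x _] := probability_inhabited mu; exact: le_trans (kdiag_ge0 Ksym Kpsd x) (Kk x).
Qed.

Let ak2 : a * k2 <= 1.
Proof.
apply: le_trans etaC; rewrite ler_wpM2r// ler_wpM2l ?(ltW eta_gt0)//.
exact: (W0_le_CW bW p_gt0 cp_gt0 Wcp).
Qed.

Hypothesis fr2 : L2 fr.

Let F := ip fr fr.
Let V := 4 * F + 4 * M ^+ 2.

Let b k := ip (iter k P fr) (iter k P fr).

Let residual_norm2_0 k : residual_norm2 rho cond K W0 eta k (fun=> 0) = (b k)%:E.
Proof.
have v2 := iter_contraction_inL2 a mK Ksym Kpsd Kk k fr2.
(* The initial residual is put in the form u + c v handled by [iter_contractionD]. *)
rewrite /residual_norm2 (_ : (fun u => 0 - fr u) = fun u => fr u + (- 2) * fr u).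
  rewrite (iter_contractionD a mK Ksym Kpsd Kk)// sqL2_ip; last exact: inL2D.
  congr (_%:E); rewrite ipDl//; last exact: inL2D.
  by rewrite !ipDr// /b; ring.
by apply/funext => u; ring.
Qed.

Let b_le k : b k <= F.
Proof.
elim: k => // k ih; apply: le_trans ih; rewrite /b iterS.
by apply: (ip_contraction_le mK Ksym Kpsd Kk a_gt0 ak2);
  exact: (iter_contraction_inL2 _ mK Ksym Kpsd Kk).
Qed.

Variables (T : nat) (eps : R).
Hypothesis T_gt0 : (0 < T)%N.
Hypothesis eps_ge0 : 0 <= eps.
Hypothesis eps_le : forall n f, (n < T)%N -> reachable M K W eta n f ->
  {ae rho, forall z : X * R, `|(W0 - weight f z) * (f z.1 - z.2)| <= eps}.

Let La := a * k2 * (1 + ln T%:R).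
Let Et := 4 * eta ^+ 2 * eps ^+ 2 * k2 * T%:R / a.

(* Young's inequality with these weights costs only a factor
   exp (sum_k dl k) <= exp 2 along the recursion, and turns the smoothing rates
   1 / (a (k + 1)) of the perturbation terms into a sum of order T / a. *)
Let dl (k : nat) : R := (Num.sqrt k.+1%:R * Num.sqrt T%:R)^-1.
Let Q (k : nat) : R := k2 / (a * k.+1%:R).
Let be k := 2 * (1 + dl k) * a ^+ 2 * Q k.
Let c k := (1 + dl k) * a ^+ 2 * Q k * V + (1 + (dl k)^-1) * eta ^+ 2 * eps ^+ 2 * Q k.

Let eta_ge0 : 0 <= eta := ltW eta_gt0.
Let W0_ge0 : 0 <= W0 := ltW W0_gt0.

Let sT_gt0 : 0 < Num.sqrt T%:R :> R. Proof. by rewrite sqrtr_gt0 ltr0n. Qed.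
Let sk_gt0 (k : nat) : 0 < Num.sqrt k.+1%:R :> R. Proof. by rewrite sqrtr_gt0 ltr0n. Qed.

Let dl_gt0 k : 0 < dl k. Proof. by rewrite invr_gt0 mulr_gt0. Qed.

Let dl1_ge0 k : 0 <= 1 + dl k.
Proof. by rewrite addr_ge0// ltW. Qed.

Let dl_le1 k : dl k <= 1.
Proof.
rewrite invf_le1 ?mulr_gt0// -[leLHS]mulr1; apply: ler_pM => //.
  by rewrite -[leLHS]sqrtr1 ler_wsqrtr// ler1n.
by rewrite -[leLHS]sqrtr1 ler_wsqrtr// ler1n.
Qed.

Let Q_ge0 k : 0 <= Q k. Proof. by rewrite divr_ge0// mulr_ge0// ltW. Qed.
Let F_ge0 : 0 <= F. Proof. exact: ip_ge0. Qed.
Let V_ge0 : 0 <= V.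
Proof. by have := sqr_ge0 M; have := F_ge0; rewrite /V; lra. Qed.

Let be_ge0 k : 0 <= be k.
Proof.
by apply: mulr_ge0 => //; apply: mulr_ge0; [exact: mulr_ge0|exact: sqr_ge0].
Qed.

Let c_ge0 k : 0 <= c k.
Proof.
have di : 0 <= 1 + (dl k)^-1 by rewrite addr_ge0// invr_ge0 ltW.
have a2 : 0 <= a ^+ 2 by exact: sqr_ge0.
have e2 : 0 <= eta ^+ 2 by exact: sqr_ge0.
have ep2 : 0 <= eps ^+ 2 by exact: sqr_ge0.
by apply: addr_ge0; apply: mulr_ge0 => //; apply: mulr_ge0 => //; apply: mulr_ge0.
Qed.

Let sum_dl : \sum_(0 <= i < T) dl i <= 2.
Proof.
under eq_bigr do rewrite /dl invfM.
rewrite -mulr_suml; apply: (@le_trans _ _ (2 * Num.sqrt T%:R / Num.sqrt T%:R)).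
  by rewrite ler_wpM2r ?invr_ge0 ?(ltW sT_gt0)//; exact: sum_inv_sqrt_le.
by rewrite mulfK// gt_eqF.
Qed.

Let aQ k : a ^+ 2 * Q k = a * k2 * k.+1%:R^-1.
Proof.
have k0 : 0 < k.+1%:R :> R by rewrite ltr0n.
by rewrite /Q; field; rewrite !gt_eqF.
Qed.

Let sum_be : \sum_(0 <= i < T) be i <= 4 * La.
Proof.
apply: (@le_trans _ _ (\sum_(0 <= i < T) 4 * a * k2 * i.+1%:R^-1)).
  apply: ler_sum => i _; rewrite /be -mulrA aQ.
  have := dl_le1 i; have : 0 <= a * k2 * i.+1%:R^-1 by rewrite -aQ mulr_ge0 ?sqr_ge0.
  have -> : 4 * a * k2 * i.+1%:R^-1 = 4 * (a * k2 * i.+1%:R^-1) by ring.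
  by set x := a * k2 * _ => x0 d1; have := ler_wpM2r x0 d1; lra.
rewrite -mulr_sumr /La; apply: (@le_trans _ _ (4 * a * k2 * (1 + ln T%:R))).
  by rewrite ler_wpM2l ?sum_inv_le// !mulr_ge0// ltW.
by rewrite !mulrA.
Qed.

Let dlQ k : (dl k)^-1 * Q k = k2 / a * Num.sqrt T%:R * (Num.sqrt k.+1%:R)^-1.
Proof.
have ss : k.+1%:R = Num.sqrt k.+1%:R ^+ 2 :> R by rewrite sqr_sqrtr.
rewrite /dl /Q invrK {2}ss; move: (sk_gt0 k); set s := Num.sqrt k.+1%:R => s0.
by field; rewrite !gt_eqF.
Qed.

Let sum_c : \sum_(0 <= i < T) c i <= 2 * La * V + Et.
Proof.
apply: (@le_trans _ _ (\sum_(0 <= i < T) (2 * a * k2 * V * i.+1%:R^-1 +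
    2 * eta ^+ 2 * eps ^+ 2 * (k2 / a) * Num.sqrt T%:R * (Num.sqrt i.+1%:R)^-1))).
  apply: ler_sum => i _; rewrite /c; apply: lerD.
    have -> : (1 + dl i) * a ^+ 2 * Q i * V = (1 + dl i) * (a ^+ 2 * Q i) * V by ring.
    rewrite aQ.
    have x0 : 0 <= a * k2 * i.+1%:R^-1 * V by rewrite -aQ mulr_ge0// mulr_ge0// sqr_ge0.
    by have := ler_wpM2r x0 (dl_le1 i); set y := i.+1%:R^-1; lra.
  have -> : (1 + (dl i)^-1) * eta ^+ 2 * eps ^+ 2 * Q i =
      eta ^+ 2 * eps ^+ 2 * (Q i + (dl i)^-1 * Q i) by ring.
  have -> : 2 * eta ^+ 2 * eps ^+ 2 * (k2 / a) * Num.sqrt T%:R * (Num.sqrt i.+1%:R)^-1 =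
    eta ^+ 2 * eps ^+ 2 * (2 * ((dl i)^-1 * Q i)) by rewrite dlQ; ring.
  apply: ler_wpM2l; first by apply: mulr_ge0; exact: sqr_ge0.
  have : 1 * Q i <= (dl i)^-1 * Q i by rewrite ler_wpM2r// invf_ge1.
  by rewrite mul1r mulr_natl mulr2n lerD2r.
rewrite big_split/= -!mulr_sumr; apply: lerD.
  have -> : 2 * La * V = 2 * a * k2 * V * (1 + ln T%:R) by rewrite /La; ring.
  by rewrite ler_wpM2l ?sum_inv_le// !mulr_ge0// ltW.
apply: (@le_trans _ _ (2 * eta ^+ 2 * eps ^+ 2 * (k2 / a) * Num.sqrt T%:R *
    (2 * Num.sqrt T%:R))).
  rewrite ler_wpM2l ?sum_inv_sqrt_le//.
  by rewrite !mulr_ge0 ?sqr_ge0 ?invr_ge0 ?mulr_ge0 ?(ltW eta_gt0) ?(ltW W0_gt0) ?(ltW sT_gt0).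
have -> : 2 * eta ^+ 2 * eps ^+ 2 * (k2 / a) * Num.sqrt T%:R * (2 * Num.sqrt T%:R) =
  4 * eta ^+ 2 * eps ^+ 2 * (k2 / a) * Num.sqrt T%:R ^+ 2 by ring.
by rewrite sqr_sqrtr// /Et; lra.
Qed.

Local Notation h := (residual_norm2 rho cond K W0 eta).
Local Notation mk := (markov rho step).

Local Notation reach := (reachable M K W eta).

Let mstep := fun d' (O : measurableType d') => @measurable_online_step R d X K W W0 eta sigma mK dW d' O.

Let mh k : measurable_functional (h k) := measurable_residual_norm2 W0 eta mK fr2 k.

Let h_rec n k : (n + k < T)%N ->
  (iter n.+1 mk (h k) (fun=> 0%R) <= (1 + dl k)%:E * iter n mk (h k.+1) (fun=> 0%R) +
    (be k)%:E * iter n mk (h 0%N) (fun=> 0%R) + (c k)%:E)%E.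
Proof.
move=> nkT; have nT : (n < T)%N by apply: leq_ltn_trans nkT; exact: leq_addr.
have h0 i f : (0 <= h i f)%E by exact: residual_norm2_ge0.
rewrite -(markov_lin rho mstep n (h0 k.+1) (h0 0%N) (mh k.+1) (mh 0%N) (dl1_ge0 k) (be_ge0 k) (c_ge0 k))//.
(* The last step of the algorithm becomes the innermost one, so the one-step estimate is applied to
   functions reachable after exactly n steps. *)
rewrite iterSr.
apply: (markov_le mstep (reachable_measurable mK) _ (m := 0%N)).
- by move=> m f; apply: (reachable_step _ M_gt0 rhoM Ksym Kpsd Kk W0_gt0 dW bW p_gt0 cp_gt0 Wcp
    eta_gt0 etaC).
- exact: (markov_ge0 rho step (h0 k) 1).
- by move=> f; rewrite !adde_ge0// ?mule_ge0 ?lee_fin.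
- exact: (@measurable_markov _ _ _ rho step mstep _ (h0 k) (mh k)).
- move=> d' O G mG; apply: emeasurable_funD => //.
  by apply: emeasurable_funD; apply: measurable_funeM; exact: mh.
- move=> f; rewrite add0n => rf.
  apply: (residual_norm2_step M_gt0 rhoM mcond rhoE mK Ksym Kpsd Kk W0_gt0 dW bW p_gt0 cp_gt0
    Wcp eta_gt0 etaC fr2 rf (eps_le nT rf) k (dl_gt0 k)).
- exact: reachable0.
Qed.

Lemma online_error_bound : 8 * expR 2 * La <= 1 ->
  (expect rho T (fun zs => sqL2 mu (fun u => (online W W0 K eta sigma zs u - fr u)%R)) <=
   (expR 2 * ip (iter T P fr) (iter T P fr) + expR 2 * La * (8 * expR 2 * F + 4 * V) +
    2 * expR 2 * Et)%:E)%E.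
Proof.
move=> La1.
have -> : expect rho T (fun zs => sqL2 mu (fun u => (online W W0 K eta sigma zs u - fr u)%R)) =
    iter T mk (h 0%N) (fun=> 0%R) by rewrite -expect_markov.
have lT : 0 <= ln T%:R :> R by rewrite ln_ge0// ler1n.
apply: (recursion_bound (H := fun n k => iter n mk (h k) (fun=> 0%R)) (dl := dl)
  (be := be) (c := c) (b := b)) => //.
- by move=> k; exact: ip_ge0.
- by move=> k; exact: ltW.
- by rewrite /Et divr_ge0 ?(ltW a_gt0)// !mulr_ge0 ?sqr_ge0.
- by rewrite /La !mulr_ge0 ?addr_ge0// ltW.
- by move=> k; rewrite /= residual_norm2_0.
Qed.

(** No smoothing here: the RKHS norm bound of [reachable] gives a pointwise bound on the iterate,
    and (f - fr)^2 <= 2 f^2 + 2 fr^2. *)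
Lemma online_error_crude :
  (expect rho T (fun zs => sqL2 mu (fun u => (online W W0 K eta sigma zs u - fr u)%R)) <=
   (2 * (k2 * (T%:R * (eta * CW W * M ^+ 2))) + 2 * F)%:E)%E.
Proof.
have -> : expect rho T (fun zs => sqL2 mu (fun u => (online W W0 K eta sigma zs u - fr u)%R)) =
    iter T mk (h 0%N) (fun=> 0%R) by rewrite -expect_markov.
have h0 i f : (0 <= h i f)%E by exact: residual_norm2_ge0.
set C := 2 * _ + _.
have C0 : 0 <= C.
  have CW0 : 0 <= CW W := le_trans W0_ge0 (W0_le_CW bW p_gt0 cp_gt0 Wcp).
  have M2 : 0 <= M ^+ 2 := sqr_ge0 M.
  by rewrite /C; apply: addr_ge0; apply: mulr_ge0 => //; apply: mulr_ge0 => //;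
    apply: mulr_ge0 => //; apply: mulr_ge0 => //; apply: mulr_ge0.
(* The constant functional is written with two zero coefficients so that [markov_lin] evaluates
   it. *)
have := markov_lin rho mstep T (h0 0%N) (h0 0%N) (mh 0%N) (mh 0%N) (lexx 0) (lexx 0) C0
  (f := fun=> 0).
rewrite !mul0e !add0e => <- //.
apply: (markov_le mstep (reachable_measurable mK) _ (m := 0%N)) => //.
- by move=> m f; apply: (reachable_step _ M_gt0 rhoM Ksym Kpsd Kk W0_gt0 dW bW p_gt0 cp_gt0 Wcp
    eta_gt0 etaC).
- by move=> f; rewrite !mul0e !add0e lee_fin.
- move=> d' O G mG; under eq_fun do rewrite !mul0e !add0e; exact: measurable_cst.
- move=> f; rewrite add0n !mul0e !add0e => rf.
  have f2 := reachable_inL2 rho mK Ksym Kpsd Kk rf.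
  rewrite /residual_norm2 /= sqL2_ip; last exact: inL2_sub.
  rewrite lee_fin ipE.
  apply: (@le_trans _ _ (\int[mu]_x (2 * (k2 * (T%:R * (eta * CW W * M ^+ 2))) + 2 * fr x ^+ 2))).
    apply: Rintegral_mono.
    + by apply: inL2_mul; exact: inL2_sub.
    + by apply: integrable_add; [exact: integrable_cst|
         apply: integrable_scale; exact: inL2_integrable].
    + move=> x; have := reachable_sqr_le Ksym Kpsd Kk x rf.
      by have := sqr_ge0 (f x + fr x); set B := k2 * _; nra.
  rewrite Rintegral_lin//; [|exact: integrable_cst|exact: inL2_integrable].
  have -> : \int[mu]_x (fr x ^+ 2) = F.
    by rewrite /F ipE; apply: eq_Rintegral => x _; rewrite expr2.
  by rewrite Rintegral_cst1.
- exact: reachable0.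
Qed.

End ErrorBound.

(** * Rates in T and sigma *)

Section Rates.
Context {R : realType}.
Variables (r p x : R).
Hypothesis r_gt0 : 0 < r.
Hypothesis x_ge2 : 2 <= x.

Local Notation theta := (2 * r / (2 * r + 1)).
Local Notation tau := (x `^ (2 * r + 1)^-1).

Let x_gt0 : 0 < x. Proof. by have := x_ge2; lra. Qed.
Let x_neq0 : x != 0. Proof. by rewrite gt_eqF. Qed.
Let x_ge1 : 1 <= x. Proof. by have := x_ge2; lra. Qed.
Let r1_gt0 : 0 < 2 * r + 1. Proof. by have := r_gt0; lra. Qed.

Lemma powR_theta_mul : x `^ (- theta) * x = tau.
Proof.
rewrite -{2}(powRr1 (ltW x_gt0)) -powRD; last by rewrite x_neq0 implybT.
by congr powR; field; rewrite gt_eqF.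
Qed.

Lemma tau_ge1 : 1 <= tau.
Proof. by rewrite -[leLHS](powRr0 x) ler_powR// invr_ge0 ltW. Qed.

Lemma tau_le : tau <= x.
Proof.
rewrite -[leRHS](powRr1 (ltW x_gt0)) ler_powR// invf_le1//.
by have := r_gt0; lra.
Qed.

Lemma tau_inv_powR : (tau^-1 `^ r) ^+ 2 = x `^ (- theta).
Proof.
rewrite -powRN -powRrM -powR_mulrn ?powR_ge0// -powRrM.
by congr powR; field; rewrite gt_eqF.
Qed.

(** In the perturbation term, eps^2 contributes tau^(2p) and one factor tau, and eta T the other. *)
Lemma tau_powR_p : (tau `^ p) ^+ 2 * tau * tau = x `^ ((2 * p + 2) / (2 * r + 1)).
Proof.
rewrite -mulrA -expr2 -!powR_mulrn ?powR_ge0// -!powRrM -powRD.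
  by congr powR; field; rewrite gt_eqF.
by rewrite x_neq0 implybT.
Qed.

Lemma powR_inv_sqr (s : R) : 0 < s -> ((s ^+ 2)^-1 `^ p) ^+ 2 = s `^ (- (4 * p)).
Proof.
move=> s0; have -> : s ^+ 2 = s `^ 2 by rewrite powR_mulrn// ltW.
rewrite -powRN -powRrM -powR_mulrn ?powR_ge0// -powRrM.
by congr powR; ring.
Qed.

(** Half of the power absorbs the logarithm: with y = x^(theta/2), 1 + ln x <= (1 + 2/theta) y, so
    the rate is at most (1 + 2/theta) / y and y is bounded. *)
Lemma le_of_log_rate (D : R) : 0 <= D -> 1 < D * (x `^ (- theta) * (1 + ln x)) ->
  x <= (D * (1 + 2 / theta)) `^ (2 / theta).
Proof.
move=> D0 H.
have t0 : 0 < theta by rewrite divr_gt0// mulr_gt0.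
set th := theta in t0 H *.
pose y := x `^ (th / 2).
have y1 : 1 <= y by rewrite /y -[leLHS](powRr0 x) ler_powR// divr_ge0// ltW.
have y0 : 0 < y by apply: lt_le_trans y1.
have lny : ln x <= 2 / th * y.
  have -> : ln x = 2 / th * ln y by rewrite /y ln_powR; field; rewrite gt_eqF.
  apply: ler_wpM2l; first by apply: divr_ge0 => //; exact: ltW.
  apply: (@le_trans _ _ (1 + ln y)); first by rewrite lerDr.
  by rewrite -[leRHS]lnK ?posrE//; exact: expR_ge1Dx.
have l1 : 1 + ln x <= (1 + 2 / th) * y by lra.
have xy : x `^ (- th) * y = y^-1.
  rewrite /y -powRN -powRD; last by rewrite x_neq0 implybT.
  by congr powR; field.
have Hy : 1 <= D * (1 + 2 / th) * y^-1.
  apply: le_trans (ltW H) _; rewrite -mulrA ler_wpM2l// -xy.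
  have -> : (1 + 2 / th) * (x `^ (- th) * y) = x `^ (- th) * ((1 + 2 / th) * y) by ring.
  by rewrite ler_wpM2l ?powR_ge0.
have yD : y <= D * (1 + 2 / th) by rewrite -(ler_pM2r (_ : 0 < y^-1)) ?invr_gt0// mulfV ?gt_eqF.
have -> : x = y `^ (2 / th).
  by rewrite /y -powRrM (_ : th / 2 * (2 / th) = 1) ?powRr1 ?ltW//; field; rewrite gt_eqF.
apply: ge0_ler_powR; rewrite ?nnegrE//.
- by apply: divr_ge0 => //; exact: ltW.
- exact: ltW.
- exact: le_trans (ltW y0) yD.
Qed.

End Rates.

Lemma window_perturbation_le {R : realType} {d : measure_display} {X : measurableType d}
    (rho : probability (X * R)%type R) (W : R -> R) (W0 p cp M B sigma : R) (f : X -> R) :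
  0 < p -> 0 < cp -> (forall s, 0 < s -> `|derive1 W s - W0| <= cp * s `^ p) -> 0 < sigma ->
  {ae rho, forall z : X * R, `|z.2| <= M} -> (forall x y, `|y| <= M -> `|f x - y| <= B) ->
  {ae rho, forall z : X * R,
     `|(W0 - Wd W W0 ((z.2 - f z.1) ^+ 2 / sigma ^+ 2)) * (f z.1 - z.2)|
       <= cp * (B ^+ 2 / sigma ^+ 2) `^ p * B}.
Proof.
move=> p0 cp0 Wcp s0 rhoM fB; move: rhoM; apply: filterS => z zM.
have xi0 : 0 <= (z.2 - f z.1) ^+ 2 / sigma ^+ 2 by apply: divr_ge0; exact: sqr_ge0.
have fz := fB z.1 z.2 zM; have B0 := le_trans (normr_ge0 _) fz.
have h := Wd_sub_le cp0 Wcp xi0.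
rewrite normrM [X in X * _]distrC; apply: ler_pM; [by []|by []| |by []].
apply: le_trans h _; apply: ler_wpM2l; first exact: ltW.
apply: ge0_ler_powR; rewrite ?nnegrE ?(ltW p0)//.
  by apply: divr_ge0; exact: sqr_ge0.
rewrite ler_wpM2r ?invr_ge0 ?sqr_ge0// -sqrrN opprB -[leLHS]real_normK ?num_real//.
by rewrite ler_pXn2r ?nnegrE.
Qed.

Ltac nonneg := repeat first [done | exact: sqr_ge0 | exact: expR_ge0 | exact: powR_ge0
  | exact: sqrtr_ge0 | exact: ltW | apply: addr_ge0 | apply: divr_ge0 | apply: mulr_ge0
  | rewrite invr_ge0].

(** * Explicit constants and the two regimes of T *)

Section Constants.
Context {R : realType}.
Variables (r p cp kap M C W0 eta0 ng nf : R).

Definition exponent : R := 2 * r / (2 * r + 1).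

(** Times sqrt tau, this bounds |f_n(x) - y| for n <= T: |f_n(x)|^2 <= kap^2 C M^2 eta T with eta T
    = tau / eta0, and |y| <= M. *)
Definition residual_scale : R := M * (1 + Num.sqrt (kap ^+ 2 * C / eta0)).

Definition perturbation_const : R :=
  4 * cp ^+ 2 * ((residual_scale ^+ 2) `^ p) ^+ 2 * residual_scale ^+ 2 * kap ^+ 2
    / (eta0 * W0).

(** The summands come from bias, variance and perturbation. The factors with ln 2 use T >= 2 to
    bound T^(-theta) by a multiple of T^(-theta) ln T. *)
Definition large_sample_const : R :=
  expR 2 * (((r * eta0 / W0) `^ r) ^+ 2 * ng ^+ 2) / ln 2
  + expR 2 * (W0 * kap ^+ 2 / eta0) * (8 * expR 2 * nf ^+ 2 + 4 * (4 * nf ^+ 2 + 4 * M ^+ 2))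
    * ((ln 2)^-1 + 1)
  + 2 * expR 2 * perturbation_const.

Definition variance_const : R := 8 * expR 2 * (W0 * kap ^+ 2 / eta0).

(* Covers the finitely many T for which variance_const * T^(-theta) (1 + ln T) > 1. *)
Definition small_sample_const : R :=
  (2 * kap ^+ 2 * C * M ^+ 2 / eta0 + 2 * nf ^+ 2)
  * (variance_const * (1 + 2 / exponent)) `^ (2 / exponent) * variance_const
  * ((ln 2)^-1 + 1).

Hypothesis M_gt0 : 0 < M.
Hypothesis W0_gt0 : 0 < W0.
Hypothesis C_ge0 : 0 <= C.
Hypothesis eta0_gt0 : 0 < eta0.
Hypothesis r_gt0 : 0 < r.

Let ln2_gt0 : 0 < ln 2 :> R. Proof. by rewrite ln_gt0// ltr1n. Qed.

Let cl_ge0 : 0 <= (ln 2)^-1 + 1 :> R.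
Proof. by nonneg. Qed.

Lemma variance_const_ge0 : 0 <= variance_const.
Proof. by rewrite /variance_const; nonneg. Qed.

Lemma residual_scale_ge0 : 0 <= residual_scale.
Proof. by rewrite /residual_scale; nonneg. Qed.

Lemma perturbation_const_ge0 : 0 <= perturbation_const.
Proof. by rewrite /perturbation_const; nonneg. Qed.

Lemma small_sample_const_ge0 : 0 <= small_sample_const.
Proof.
by have v0 := variance_const_ge0; rewrite /small_sample_const; nonneg.
Qed.

Lemma large_sample_const_ge0 : 0 <= large_sample_const.
Proof.
by have p0 := perturbation_const_ge0; rewrite /large_sample_const; nonneg.
Qed.

Variables (sigma x : R).
Hypothesis sigma_gt0 : 0 < sigma.
Hypothesis x_ge2 : 2 <= x.

Let theta := exponent.
Let tau := x `^ (2 * r + 1)^-1.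
Let eta := eta0^-1 * x `^ (- theta).
Let B := residual_scale * Num.sqrt tau.
Let eps := cp * (B ^+ 2 / sigma ^+ 2) `^ p * B.
Let m1 := x `^ (- theta) * ln x.
Let m2 := x `^ ((2 * p + 2) / (2 * r + 1)) * sigma `^ (- (4 * p)).
Let La := eta * W0 * kap ^+ 2 * (1 + ln x).

Let x_gt0 : 0 < x. Proof. by have := x_ge2; lra. Qed.
Let tau_gt0 : 0 < tau. Proof. exact: powR_gt0. Qed.
Let xt_gt0 : 0 < x `^ (- theta). Proof. exact: powR_gt0. Qed.
Let lnx : ln 2 <= ln x. Proof. by rewrite ler_ln ?posrE. Qed.

Lemma step_size_mul : eta * x = tau / eta0.
Proof. by rewrite /eta -mulrA powR_theta_mul// mulrC. Qed.

Let rate_le : x `^ (- theta) <= m1 / ln 2.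
Proof.
by rewrite ler_pdivlMr// /m1 ler_wpM2l ?(ltW xt_gt0).
Qed.

Let rate_log_le : x `^ (- theta) * (1 + ln x) <= ((ln 2)^-1 + 1) * m1.
Proof. by rewrite mulrDr mulr1 mulrDl mul1r [_^-1 * _]mulrC lerD. Qed.

Let LaE : La = W0 * kap ^+ 2 / eta0 * (x `^ (- theta) * (1 + ln x)).
Proof. by rewrite /La /eta; ring. Qed.

Let m1_gt0 : 0 < m1.
Proof. by rewrite mulr_gt0// (lt_le_trans ln2_gt0). Qed.

Let perturbationE : 4 * eta ^+ 2 * eps ^+ 2 * kap ^+ 2 * x / (eta * W0) =
  perturbation_const * m2.
Proof.
have e0 : eta != 0 by rewrite gt_eqF// mulr_gt0// invr_gt0.
have -> : 4 * eta ^+ 2 * eps ^+ 2 * kap ^+ 2 * x / (eta * W0) =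
    4 * (eta * x) * eps ^+ 2 * kap ^+ 2 / W0.
  by field; rewrite e0 gt_eqF.
rewrite step_size_mul /eps.
have B2 : B ^+ 2 = residual_scale ^+ 2 * tau.
  by rewrite /B exprMn sqr_sqrtr// ltW.
have s2 : 0 <= (sigma ^+ 2)^-1 by rewrite invr_ge0 sqr_ge0.
have -> : (cp * (B ^+ 2 / sigma ^+ 2) `^ p * B) ^+ 2 =
    cp ^+ 2 * ((B ^+ 2 / sigma ^+ 2) `^ p) ^+ 2 * B ^+ 2 by ring.
have -> : (B ^+ 2 / sigma ^+ 2) `^ p =
    (residual_scale ^+ 2) `^ p * (tau `^ p * (sigma ^+ 2)^-1 `^ p).
  rewrite B2 -mulrA powRM; [|exact: sqr_ge0|by nonneg].
  by rewrite powRM//; exact: ltW.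
have -> : m2 = (tau `^ p) ^+ 2 * tau * tau * ((sigma ^+ 2)^-1 `^ p) ^+ 2.
  by rewrite (powR_inv_sqr p sigma_gt0) /tau (tau_powR_p p r_gt0 x_ge2).
rewrite B2.
rewrite /perturbation_const; set c1 := _ `^ p; set c2 := _ `^ p; set c3 := _ `^ p.
by field; rewrite !gt_eqF.
Qed.

Lemma large_sample_rate :
  expR 2 * ((r / (eta * W0 * x)) `^ r ^+ 2 * ng ^+ 2)
  + expR 2 * La * (8 * expR 2 * nf ^+ 2 + 4 * (4 * nf ^+ 2 + 4 * M ^+ 2))
  + 2 * expR 2 * (4 * eta ^+ 2 * eps ^+ 2 * kap ^+ 2 * x / (eta * W0))
  <= large_sample_const * Num.max m1 m2.
Proof.
have e2 := expR_ge0 (2 : R); have nf2 := sqr_ge0 nf; have M2 := sqr_ge0 M.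
have h1 : m1 <= Num.max m1 m2 by rewrite le_max lexx.
have h2 : m2 <= Num.max m1 m2 by rewrite le_max lexx orbT.
rewrite /large_sample_const [leRHS]mulrDl [X in _ <= X + _]mulrDl; apply: lerD; first apply: lerD.
- have -> : r / (eta * W0 * x) = r * eta0 / W0 * tau^-1.
    have -> : eta * W0 * x = eta * x * W0 by ring.
    by rewrite step_size_mul; field; rewrite !gt_eqF.
  rewrite powRM; [|by nonneg|by nonneg].
  rewrite exprMn tau_inv_powR// -/theta.
  set c := (_ `^ r) ^+ 2.
  have -> : expR 2 * (c * x `^ (- theta) * ng ^+ 2) = expR 2 * (c * ng ^+ 2) * x `^ (- theta).
    by ring.
  rewrite -[leRHS]mulrA; apply: ler_wpM2l; first by rewrite /c; nonneg.
  apply: le_trans rate_le _; rewrite mulrC; apply: ler_wpM2l => //.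
  by rewrite invr_ge0 ltW.
- rewrite LaE; set G := 8 * _ * _ + _.
  have G0 : 0 <= G by rewrite /G; nonneg.
  set c := W0 * _ / _.
  have -> : expR 2 * (c * (x `^ (- theta) * (1 + ln x))) * G =
    expR 2 * c * G * (x `^ (- theta) * (1 + ln x)) by ring.
  rewrite -[leRHS]mulrA; apply: ler_wpM2l; first by rewrite /c; nonneg.
  by apply: le_trans rate_log_le _; apply: ler_wpM2l.
- rewrite perturbationE mulrA; apply: ler_wpM2l => //.
  by have p0 := perturbation_const_ge0; nonneg.
Qed.

Lemma small_sample_rate : 1 < 8 * expR 2 * La ->
  2 * (kap ^+ 2 * (x * (eta * C * M ^+ 2))) + 2 * nf ^+ 2 <= small_sample_const * Num.max m1 m2.
Proof.
move=> La1; have nf2 := sqr_ge0 nf; have M2 := sqr_ge0 M; have k2 := sqr_ge0 kap.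
have h1 : m1 <= Num.max m1 m2 by rewrite le_max lexx.
have HD : 1 < variance_const * (x `^ (- theta) * (1 + ln x)).
  by move: La1; rewrite LaE /variance_const mulrA.
have xT : x <= (variance_const * (1 + 2 / exponent)) `^ (2 / exponent).
  exact: (le_of_log_rate r_gt0 x_ge2 variance_const_ge0 HD).
have t1 := tau_ge1 r_gt0 x_ge2; have tx := tau_le r_gt0 x_ge2; rewrite -/tau in t1 tx.
set A := 2 * kap ^+ 2 * C * M ^+ 2 / eta0 + 2 * nf ^+ 2.
have A0 : 0 <= A.
  by rewrite /A; nonneg.
apply: (@le_trans _ _ (A * tau)).
  have -> : 2 * (kap ^+ 2 * (x * (eta * C * M ^+ 2))) =
      2 * kap ^+ 2 * C * M ^+ 2 * (eta * x) by ring.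
  rewrite step_size_mul /A [leRHS]mulrDl; apply: lerD.
    by rewrite le_eqVlt; apply/orP; left; apply/eqP; ring.
  by rewrite ler_peMr// mulr_ge0.
have -> : small_sample_const * Num.max m1 m2 =
    A * ((variance_const * (1 + 2 / exponent)) `^ (2 / exponent) *
      (variance_const * (((ln 2)^-1 + 1) * Num.max m1 m2))).
  by rewrite /small_sample_const -/A; set v := variance_const; set w := _ `^ _; ring.
apply: ler_wpM2l => //.
apply: le_trans tx _; apply: le_trans xT _.
(* T is bounded here, so the rate is brought back by multiplying by a quantity exceeding 1, namely
   the one in [HD]. *)
rewrite -[leLHS]mulr1; apply: ler_wpM2l; first exact: powR_ge0.
apply: le_trans (ltW HD) _; apply: ler_wpM2l; first exact: variance_const_ge0.
by apply: le_trans rate_log_le _; apply: ler_wpM2l.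
Qed.

Lemma residual_scale_le f y : f ^+ 2 <= kap ^+ 2 * (x * (eta * C * M ^+ 2)) -> `|y| <= M ->
  `|f - y| <= B.
Proof.
move=> f2 yM; have t1 := tau_ge1 r_gt0 x_ge2; rewrite -/tau in t1.
have st1 : 1 <= Num.sqrt tau by rewrite -[leLHS]sqrtr1 ler_wsqrtr.
have c0 : 0 <= kap ^+ 2 * C / eta0.
  by nonneg.
have fB : `|f| <= M * Num.sqrt (kap ^+ 2 * C / eta0) * Num.sqrt tau.
  rewrite -(ler_pXn2r (n := 2))// ?nnegrE//; last first.
    by nonneg.
  rewrite real_normK ?num_real// !exprMn !sqr_sqrtr ?(ltW tau_gt0)//.
  apply: le_trans f2 _.
  have -> : kap ^+ 2 * (x * (eta * C * M ^+ 2)) = kap ^+ 2 * C * M ^+ 2 * (eta * x) by ring.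
  by rewrite step_size_mul le_eqVlt; apply/orP; left; apply/eqP; ring.
apply: le_trans (ler_normB _ _) _.
have yB : `|y| <= M * Num.sqrt tau.
  by apply: le_trans yM _; rewrite ler_peMr// ltW.
by rewrite /B /residual_scale mulrDr mulr1 mulrDl addrC lerD.
Qed.

End Constants.

Theorem theorem1 (R : realType) :
  exists C : R -> R -> R -> R -> R -> R -> R -> R -> R -> R -> R -> R,
  forall (d : measure_display) (X : measurableType d)
    (rho : probability (X * R)%type R) (M : R)
    (cond : X -> probability R R)
    (K : X -> X -> R) (W : R -> R) (W0 p cp r : R) (g : X -> R) (eta0 : R),
    (* bounded outputs *)
    0 < M ->
    {ae rho, forall z : X * R, `|z.2| <= M} ->
    (* rho(.|x) is the conditional distribution (disintegration of rho) *)
    (forall B, measurable B -> measurable_fun [set: X] (fun x : X => cond x B)) ->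
    (forall A B, measurable A -> measurable B ->
       rho (A `*` B) = (\int[marginal rho]_(x in A) cond x B)%E) ->
    (* the kernel *)
    measurable_fun setT (fun xy : X * X => K xy.1 xy.2) ->
    (forall x x', K x x' = K x' x) ->
    psd_kernel K ->
    has_ubound [set Num.sqrt (K x x) | x in setT] ->
    (* (W1) *)
    (fun h : R => (W h - W 0) / h) @ (0 : R)^'+ --> W0 ->
    0 < W0 ->
    (forall s, 0 < s -> derivable W s 1 /\ 0 < derive1 W s) ->
    has_ubound [set `|derive1 W s| | s in `]0, +oo[%classic] ->
    (* (W2) *)
    0 < p -> 0 < cp ->
    (forall s, 0 < s -> `|derive1 W s - W0| <= cp * s `^ p) ->
    (* regularity f_rho = L_K^r g_rho *)
    0 < r ->
    inL2 (marginal rho) g ->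
    is_LKpow (marginal rho) K r g (regression cond) ->
    (* step size parameter *)
    Num.max (CW W * kappa K ^+ 2)
            (((expR 1)^-1 + 2 * kappa K ^+ 2 * W0) ^+ 2) <= eta0 ->
    forall (T : nat) (sigma : R), (2 <= T)%N -> 0 < sigma ->
    let eta := eta0^-1 * T%:R `^ (- (2 * r / (2 * r + 1))) in
    (expect rho T (fun zs =>
        sqL2 (marginal rho) (fun u => (online W W0 K eta sigma zs u - regression cond u)%R))
     <= (C r p cp (kappa K) M (CW W) W0 eta0
           (normL2 (marginal rho) g) (normL2 (marginal rho) (regression cond))
           (fine (lsq_error rho (regression cond)))
         * Num.max (T%:R `^ (- (2 * r / (2 * r + 1))) * ln T%:R)
                   (T%:R `^ ((2 * p + 2) / (2 * r + 1)) * sigma `^ (- (4 * p)))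
        )%:E)%E.
Proof.
(* One constant for each of the two regimes of T; both being nonnegative, their sum serves in
   either. *)
exists (fun r p cp kap M C W0 eta0 ng nf _ =>
  large_sample_const r p cp kap M C W0 eta0 ng nf + small_sample_const r kap M C W0 eta0 nf).
move=> d X rho M cond K W W0 p cp r g eta0 M0 rhoM mcond rhoE mK Ksym Kpsd Kbd _ W00 dW bW
  p0 cp0 Wcp r0 g2 [lam [phi [spec cvfr]]] eta0_ge T sigma T2 s0.
set eta := eta0^-1 * _ => /=.
have C0 : 0 <= CW W := le_trans (ltW W00) (W0_le_CW bW p0 cp0 Wcp).
have eta0_gt0 : 0 < eta0.
  (* The first term of the maximum vanishes when the kernel does; the second is the square of a
     number at least 1/e. *)
  apply: lt_le_trans eta0_ge; rewrite lt_max; apply/orP; right.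
  rewrite exprn_gt0// ltr_pwDl ?invr_gt0 ?expR_gt0//.
  by nonneg.
set k2 := kappa K ^+ 2.
have Kk x : K x x <= k2.
  rewrite -[leLHS]sqr_sqrtr ?(kdiag_ge0 Ksym Kpsd)//.
  have h : Num.sqrt (K x x) <= kappa K by apply: ub_le_sup => //; exists x.
  by rewrite /k2 ler_pXn2r ?nnegrE ?sqrtr_ge0// (le_trans _ h) ?sqrtr_ge0.
have x2 : 2 <= T%:R :> R by rewrite ler_nat.
have x0 : 0 < T%:R :> R by apply: lt_le_trans x2.
have T0 : (0 < T)%N by apply: leq_trans T2.
have eta_gt0 : 0 < eta by rewrite mulr_gt0 ?invr_gt0// powR_gt0.
have etaC : eta * CW W * k2 <= 1.
  have r1 : T%:R `^ (- (2 * r / (2 * r + 1))) <= 1.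
    rewrite -[leRHS](powRr0 T%:R) ler_powR//; first by have := x2; lra.
    by rewrite oppr_le0 divr_ge0 ?addr_ge0// mulr_ge0// ltW.
  have : CW W * k2 <= eta0 by apply: le_trans eta0_ge; rewrite le_max lexx.
  move=> Ck; rewrite /eta; apply: (@le_trans _ _ (eta0^-1 * 1 * eta0)); last first.
    by rewrite mulr1 mulVf// gt_eqF.
  rewrite -[leLHS]mulrA; apply: ler_pM; [exact: ltW|by nonneg| |exact: Ck].
  by apply: ler_wpM2l => //; rewrite invr_ge0 ltW.
pose mu := marginal_probability rho.
have g2' : inL2 mu g by exact: g2.
have spec' : spectral_system mu K lam phi by exact: spec.
have phi2 i : inL2 mu (phi i) by case: spec'.
have s2 n : inL2 mu (fun u => \sum_(i < n) (lam i `^ r) * ipL2 mu g (phi i) * phi i u).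
  by apply: (@inL2_sum _ _ _ mu n (fun i u => (lam i `^ r) * ipL2 mu g (phi i) * phi i u)) => i;
    exact: inL2Z.
have fr2 : inL2 mu (regression cond).
  exact: (sqL2_cvg_inL2 (measurable_regression mcond) s2 cvfr).
have ng : normL2 (marginal rho) g ^+ 2 = ipL2 mu g g by exact: (normL2_sqr g2').
have nf : normL2 (marginal rho) (regression cond) ^+ 2 = ipL2 mu (regression cond) (regression cond).
  exact: (normL2_sqr fr2).
pose B := residual_scale (kappa K) M (CW W) eta0 * Num.sqrt (T%:R `^ (2 * r + 1)^-1).
pose eps := cp * (B ^+ 2 / sigma ^+ 2) `^ p * B.
have B0 : 0 <= B by rewrite mulr_ge0 ?sqrtr_ge0// residual_scale_ge0.
have eps0 : 0 <= eps by rewrite /eps; nonneg.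
have eps_le n f : (n < T)%N -> reachable M K W eta n f ->
    {ae rho, forall z : X * R,
      `|(W0 - Wd W W0 ((z.2 - f z.1) ^+ 2 / sigma ^+ 2)) * (f z.1 - z.2)| <= eps}.
  move=> nT rf; apply: (window_perturbation_le p0 cp0 Wcp s0 rhoM) => x y yM.
  apply: residual_scale_le => //; apply: le_trans (reachable_sqr_le Ksym Kpsd Kk x rf) _.
  rewrite ler_wpM2l ?sqr_ge0// ler_wpM2r ?ler_nat ?(ltnW nT)//.
  by nonneg.
set mx := Num.max _ _.
have mx0 : 0 <= mx.
  rewrite le_max mulr_ge0 ?powR_ge0// ln_ge0//; have := x2; lra.
(* The dichotomy is exactly the absorption condition of [online_error_bound]; its failure bounds
   T. *)
have [small|large] := lerP (8 * expR 2 * (eta * W0 * k2 * (1 + ln T%:R))) 1.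
  apply: le_trans (online_error_bound M0 rhoM mcond rhoE mK Ksym Kpsd Kk W00 dW bW p0 cp0 Wcp
    eta_gt0 etaC fr2 T0 eps0 eps_le small) _.
  rewrite lee_fin [leRHS]mulrDl; apply: (@le_trans _ _ (large_sample_const r p cp (kappa K) M (CW W) W0 eta0
    (normL2 (marginal rho) g) (normL2 (marginal rho) (regression cond)) * mx)); last first.
    by rewrite lerDl mulr_ge0// small_sample_const_ge0.
  have ak2 : eta * W0 * k2 <= 1.
    apply: le_trans etaC; rewrite ler_wpM2r ?sqr_ge0// ler_wpM2l ?(ltW eta_gt0)//.
    exact: (W0_le_CW bW p0 cp0 Wcp).
  have bias := spectral_bias mK Ksym Kpsd Kk (mulr_gt0 eta_gt0 W00) ak2 spec' r0 g2' fr2 cvfr T0.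
  apply: le_trans (large_sample_rate p cp (kappa K) M (CW W)
    (normL2 (marginal rho) g) (normL2 (marginal rho) (regression cond)) W00 eta0_gt0 r0 s0 x2).
  rewrite ng nf; apply: lerD => //; apply: lerD => //.
  by rewrite ler_wpM2l ?expR_ge0.
apply: le_trans (online_error_crude sigma M0 rhoM mK Ksym Kpsd Kk W00 dW bW p0 cp0 Wcp
  eta_gt0 etaC fr2 T) _.
rewrite lee_fin [leRHS]mulrDl -nf; apply: le_trans (_ : _ <= small_sample_const _ _ _ _ _ _ _ * mx) _.
  exact: (small_sample_rate p M _ W00 C0 eta0_gt0 r0 sigma x2 large).
by rewrite lerDr mulr_ge0// large_sample_const_ge0.
Qed.
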